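(* Let $1<p<\infty$ and $0<\alpha<\infty$. Then: (1) the Fréchet-Schwartz space $A^p_{\alpha+}$ fails to be nuclear; (2) the (DFS)-space $A^p_{\alpha-}$ fails to be nuclear.
   Context: $\mathbb{D}=\{z\in\mathbb{C}:|z|<1\}$, $H(\mathbb{D})$ is the space of all analytic functions on $\mathbb{D}$, and $\mathbb{N}=\{1,2,\dots\}$. For $1<p<\infty$ and $0<\mu<\infty$, the weighted Bergman space $A^p_\mu$ is the Banach space of all $f\in H(\mathbb{D})$ with $\|f\|_{p,\mu}:=\left(\int_{\mathbb{D}}|f(z)|^p(1-|z|)^\mu\,ds(z)\right)^{1/p}<\infty$, where $ds(z)=\frac1\pi\,dx\,dy$. For $0<\alpha<\infty$, $A^p_{\alpha+}:=\bigcap_{\mu>\alpha}A^p_\mu=\bigcap_{n\in\mathbb{N}}A^p_{\alpha+1/n}$, a Fréchet space (in fact Fréchet-Schwartz) with the topology generated by the increasing sequence of norms $\|\cdot\|_{p,\alpha+1/n}$, $n\in\mathbb{N}$. For $0<\alpha<\infty$, $A^p_{\alpha-}:=\bigcup_{0<\mu<\alpha}A^p_\mu=\bigcup_{n\in\mathbb{N},\,n>1/\alpha}A^p_{\alpha-1/n}$, with the finest locally convex topology for which all inclusions $A^p_\mu\hookrightarrow A^p_{\alpha-}$, $0<\mu<\alpha$, are continuous (i.e. the (LB)-space that is the inductive limit of the Banach spaces $A^p_{\alpha-1/n}$; it is in fact a (DFS)-space, that is, the strong dual of a Fréchet-Schwartz space). Nuclear is meant in the usual sense for locally convex spaces. 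*)

(* Defs.v *)
From HB Require Import structures.
From mathcomp Require Import all_boot all_order all_algebra.
From mathcomp Require Import all_classical all_reals all_analysis.
From mathcomp Require Import measurable_realfun.
From mathcomp Require Import complex.
From mathcomp Require Import ring lra.

Set Implicit Arguments.
Unset Strict Implicit.
Unset Printing Implicit Defensive.

Import Order.TTheory GRing.Theory Num.Theory.
Import numFieldNormedType.Exports.
Import ComplexField.Normc.

Local Open Scope classical_set_scope.
Local Open Scope ring_scope.
Local Open Scope complex_scope.

Section Submodule.
Context (K : numFieldType) (V : lmodType K).

Lemma submod_closed_set (S : set V) : S 0 ->
  (forall a x y, S x -> S y -> S (a *: x + y)) ->
  submod_closed [pred x | x \in S].
Proof. by move=> S0 SD; split=> [|a x y]; rewrite !inE//; exact: SD. Qed.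

Record submod := Submod {
  submod_set :> set V;
  submod_closedP : submod_closed [pred x | x \in submod_set] }.

Definition submod_pred (W : submod) : {pred V} := [pred x | x \in submod_set W].

HB.instance Definition _ (W : submod) :=
  GRing.isSubmodClosed.Build K V (submod_pred W) (submod_closedP W).

Record subspace_of (W : submod) := Subspace {
  subspace_val :> V;
  _ : submod_pred W subspace_val }.

HB.instance Definition _ W := [isSub for @subspace_val W].
HB.instance Definition _ W := [Choice of subspace_of W by <:].
HB.instance Definition _ W := [SubChoice_isSubLmodule of subspace_of W by <:].

End Submodule.

Section LocallyConvex.
Context (K : numFieldType) (V : lmodType K).

Definition absconvex (U : set V) := forall (x y : V) (a b : K),
  U x -> U y -> `|a| + `|b| <= 1 -> U (a *: x + b *: y).

(* A base of absolutely convex neighbourhoods of 0 for a locally convex vector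
   topology on V; the neighbourhoods of x are the translates by x. *)
Record lc_base := LcBase {
  lc_nbhs0 : set (set V);
  lc_nonempty : exists U, lc_nbhs0 U;
  lc_setI : forall U W, lc_nbhs0 U -> lc_nbhs0 W ->
    exists2 Z, lc_nbhs0 Z & Z `<=` U `&` W;
  lc_scale : forall U (r : K), lc_nbhs0 U -> 0 < r ->
    exists2 W, lc_nbhs0 W & forall x, W x -> U (r *: x);
  lc_absconvex : forall U, lc_nbhs0 U -> absconvex U;
  lc_absorbing : forall U x, lc_nbhs0 U -> exists2 r : K, 0 < r & U (r *: x) }.

Definition lc_space (B : lc_base) : Type := V.

Variable B : lc_base.

HB.instance Definition _ := GRing.Lmodule.on (lc_space B).

Definition lc_nbhs (x : lc_space B) : set_system (lc_space B) :=
  [set A | exists2 U, lc_nbhs0 B U & forall u, U u -> A (x + u)].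

HB.instance Definition _ := hasNbhs.Build (lc_space B) lc_nbhs.

Lemma lc0 U : lc_nbhs0 B U -> U 0.
Proof.
move=> BU; have [r r0 Ur] := lc_absorbing 0 BU.
by rewrite -[0](scaler0 _ r).
Qed.

Lemma absconvexZ U c x : absconvex U -> `|c| <= 1 -> U x -> U (c *: x).
Proof.
move=> aU c1 Ux; have := aU x x c 0 Ux Ux.
by rewrite scale0r addr0 normr0 addr0; exact.
Qed.

Let lc_nbhs_filter (x : lc_space B) : ProperFilter (nbhs x).
Proof.
split.
  by move=> [U BU /(_ 0)]; apply; exact: lc0.
split.
- by have [U BU] := lc_nonempty B; exists U.
- move=> P Q [U BU UP] [W BW WQ]; have [Z BZ ZUW] := lc_setI BU BW.
  by exists Z => // u /ZUW[Uu Wu]; split; [exact: UP|exact: WQ].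
- by move=> P Q PQ [U BU UP]; exists U => // u /UP /PQ.
Qed.

Let lc_nbhs_singleton (x : lc_space B) (A : set (lc_space B)) :
  nbhs x A -> A x.
Proof. by move=> [U BU UA]; rewrite -[x]addr0; exact: UA (lc0 BU). Qed.

Lemma lc_half U : lc_nbhs0 B U ->
  exists2 W, lc_nbhs0 B W & forall x y, W x -> W y -> U (x + y).
Proof.
move=> BU; have [W BW WU] := lc_scale BU (ltr0n K 2).
exists W => // x y Wx Wy.
have -> : x + y = 2 *: (2^-1 *: x + 2^-1 *: y).
  by rewrite scalerDr !scalerA divff ?pnatr_eq0// !scale1r.
apply: WU; apply: (lc_absconvex BW) => //.
by rewrite ger0_norm ?invr_ge0// -mulr2n -[_^-1 *+ _]mulr_natr mulVf// pnatr_eq0.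
Qed.

Let lc_nbhs_nbhs (x : lc_space B) (A : set (lc_space B)) :
  nbhs x A -> nbhs x (nbhs^~ A).
Proof.
move=> [U BU UA]; have [W BW WU] := lc_half BU.
exists W => // u Wu; exists W => // v Wv.
by rewrite -addrA; apply: UA; apply: WU.
Qed.

HB.instance Definition _ := Nbhs_isNbhsTopological.Build (lc_space B)
  lc_nbhs_filter lc_nbhs_singleton lc_nbhs_nbhs.

Let lc_add_continuous :
  continuous (fun x : lc_space B * lc_space B => x.1 + x.2).
Proof.
move=> [x y] A [U BU UA]; have [W BW WU] := lc_half BU.
exists ([set x + u | u in W], [set y + u | u in W]) => /=.
  by split; exists W => // u Wu; exists u.
move=> [a b] [/= [u Wu <-] [v Wv <-]] /=.
by rewrite addrACA; apply: UA; apply: WU.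
Qed.

Let lc_scale_continuous :
  continuous (fun z : K^o * lc_space B => z.1 *: z.2).
Proof.
move=> [k x] A [U BU UA]; have [W BW WU] := lc_half BU.
have k1 : 0 < `|k| + 1 by rewrite ltr_wpDl.
have [Z BZ ZW] := lc_scale BW k1.
have [r r0 Wr] := lc_absorbing x BW.
exists (ball k (Num.min r 1), [set x + u | u in Z]) => /=.
  split; first by apply: nbhsx_ballx; rewrite comparable_lt_min ?r0 ?ltr01//;
    apply/real_comparable; rewrite ?ger0_real ?ltW.
  by exists Z => // u Zu; exists u.
move=> [l y] [/= + [u Zu <-]] /=.
have cr : r >=< 1 by apply/real_comparable; rewrite ?ger0_real ?ltW.
rewrite -ball_normE /= comparable_lt_min// => /andP[lr l1].
have -> : l *: (x + u) = k *: x + ((l - k) *: x + l *: u).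
  by rewrite scalerDr addrA -scalerDl addrCA subrr addr0.
apply: UA; apply: WU.
  have -> : (l - k) *: x = ((l - k) / r) *: (r *: x).
    by rewrite scalerA divfK// gt_eqF.
  apply: absconvexZ => //; first exact: (lc_absconvex BW).
  by rewrite normf_div (gtr0_norm r0) ler_pdivrMr// mul1r distrC ltW.
have -> : l *: u = (l / (`|k| + 1)) *: ((`|k| + 1) *: u).
  by rewrite scalerA divfK// gt_eqF.
apply: absconvexZ; [exact: (lc_absconvex BW)| |exact: ZW].
rewrite normf_div (gtr0_norm k1) ler_pdivrMr// mul1r.
rewrite -[l](subrK k) addrC (le_trans (ler_normD _ _))// lerD2l.
by rewrite distrC ltW.
Qed.

Let lc_locally_convex : exists2 D : set_system (lc_space B),
  (forall b, b \in D -> convex_set b) & basis D.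
Proof.
exists [set A | open A /\ convex_set A]; first by move=> A /[!inE] -[].
split; first by move=> A [].
move=> x A [U BU UA].
pose xU : set (lc_space B) := [set x + u | u in U].
exists (interior xU); last first.
  by move=> y /interior_subset [u Uu <-]; exact: UA.
split; last by exists U => // u Uu; exists u.
split; first exact: open_interior.
move=> y z l /[!inE] -[U1 BU1 U1x] [U2 BU2 U2x].
have [Z BZ ZU] := lc_setI BU1 BU2.
exists Z => // w /ZU[/U1x[u Uu yE] /U2x[v Uv zE]].
exists (l%:num *: u + (1 - l%:num) *: v).
  apply: (lc_absconvex BU) => //.
  by rewrite !ger0_norm ?subr_ge0// addrC subrK.
have -> : conv l y z = l%:num *: (y : V) + (1 - l%:num) *: (z : V) by [].
have lE (a : V) : l%:num *: a + (1 - l%:num) *: a = a.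
  by rewrite -scalerDl addrC subrK scale1r.
rewrite -[w in RHS]lE addrACA -!scalerDr.
rewrite (_ : (y : V) + w = x + u)// (_ : (z : V) + w = x + v)//.
by rewrite !scalerDr addrACA lE.
Qed.

HB.instance Definition _ := PreTopologicalLmod_isTvs.Build K (lc_space B)
  lc_add_continuous lc_scale_continuous lc_locally_convex.
HB.instance Definition _ :=
  PreTopologicalNmodule_isTopologicalNmodule.Build (lc_space B)
    lc_add_continuous.
HB.instance Definition _ :=
  TopologicalNmodule_isTopologicalLmodule.Build K (lc_space B)
    lc_scale_continuous.
HB.instance Definition _ :=
  Uniform_isTvs.Build K (lc_space B) lc_locally_convex.

End LocallyConvex.

Section Bergman.
Context (R : realType).
Implicit Types (f g : R[i] -> R[i]) (p mu : R) (z : R[i]) (w : R * R).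

(* A function on the open unit disc is encoded by its extension by 0 to the
   whole plane, so that equality of encodings is equality on the disc. *)
Definition analytic_disc : set (R[i] -> R[i]) :=
  [set f | (forall z, `|z| < 1 -> derivable (f : R[i]^o -> R[i]^o) z 1) /\
           (forall z, ~ (`|z| < 1) -> f z = 0)].

Definition unit_disc : set (R * R) := [set w | normc (w.1 +i* w.2) < 1].

Definition bergman_int p mu f : \bar R :=
  ((pi^-1)%:E * \int[@lebesgue_measure R \x @lebesgue_measure R]_(w in unit_disc)
    (normc (f (w.1 +i* w.2)%C) `^ p * (1 - normc (w.1 +i* w.2)%C) `^ mu)%:E)%E.

Definition bergman_norm p mu f : R := fine (bergman_int p mu f) `^ p^-1.

Definition bergman p mu : set (R[i] -> R[i]) :=
  [set f | analytic_disc f /\ (bergman_int p mu f < +oo)%E].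

Lemma open_prod_measurable (O : set (R * R)) : open O ->
  measurable (O : set (measurableTypeR R * measurableTypeR R)).
Proof.
move=> oO.
pose q (x : rat * rat * rat) : set (R * R) :=
  ball (ratr x.1.1 : R) (ratr x.2 : R) `*` ball (ratr x.1.2 : R) (ratr x.2 : R).
have -> : O = \bigcup_(x in [set x | q x `<=` O]) q x.
  apply/seteqP; split => [[a b] Oab|w [x qxO /qxO//]].
  have : nbhs (a, b) O by exact: open_nbhs_nbhs.
  move=> [[A B] /= [/nbhs_ballP[e1/= e10 e1A] /nbhs_ballP[e2 /= e20 e2B]] ABO].
  pose e := Num.min e1 e2.
  have e0 : 0 < e by rewrite lt_min e10.
  have [r] : exists r : rat, ratr r \in `]0, (e / 2)[.
    by apply: rat_in_itvoo; rewrite divr_gt0.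
  rewrite in_itv/= => /andP[r0 re].
  have near_rat (c : R) : exists s : rat, `|ratr s - c| < ratr r.
    have [s] : exists s : rat, ratr s \in `]c, (c + ratr r)[.
      by apply: rat_in_itvoo; rewrite ltrDl.
    rewrite in_itv/= => /andP[cs sc]; exists s.
    by rewrite gtr0_norm ?subr_gt0// ltrBlDl.
  have [s sa] := near_rat a; have [t tb] := near_rat b.
  exists (s, t, r); last by split; rewrite /= -ball_normE.
  move=> [x y] [/=]; rewrite -!ball_normE/= => sx ty; apply: ABO; split => /=.
    apply: e1A; rewrite -ball_normE /=.
    rewrite -[a](subrK (ratr s)) -addrA (le_lt_trans (ler_normD _ _))//.
    rewrite distrC (lt_le_trans (ltrD sa sx))//.
    rewrite (le_trans (ltW (ltrD re re)))//.
    by rewrite -splitr ge_min lexx.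
  apply: e2B; rewrite -ball_normE /=.
  rewrite -[b](subrK (ratr t)) -addrA (le_lt_trans (ler_normD _ _))//.
  rewrite distrC (lt_le_trans (ltrD tb ty))//.
  rewrite (le_trans (ltW (ltrD re re)))//.
  by rewrite -splitr ge_min lexx orbT.
rewrite bigcup_mkcond; apply: countable_bigcupT_measurable => //= x.
case: ifP => _; last exact: measurable0.
by apply: measurableX; apply: open_measurable; exact: ball_open.
Qed.

Lemma continuous_disc_measurable (h : R * R -> R) (D : set (R * R)) :
  open D -> (forall w, D w -> {for w, continuous h}) ->
  (forall w, ~ D w -> h w = 0) ->
  measurable_fun [set: measurableTypeR R * measurableTypeR R]
    (h : _ -> measurableTypeR R).
Proof.
move=> oD ch h0.
apply: (measurability _ (RGenOInfty.measurableE R)) => _ [_ [x ->] <-].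
rewrite setTI.
have mD := open_prod_measurable oD.
rewrite (_ : _ @^-1` _ = (D `&` h @^-1` `]x, +oo[) `|`
   (if 0 > x then ~` D else set0)).
  apply: measurableU; last by case: ifP => _ //; exact: measurableC.
  apply: open_prod_measurable; rewrite openE => w [Dw xw].
  near=> u; split; near: u; first exact: open_nbhs_nbhs.
  by apply: (ch w Dw); apply: open_nbhs_nbhs; split => //; rewrite set_itvoy; exact: open_gt.
apply/seteqP; split => w /=.
  have [Dw|Dw] := pselect (D w) => xw; first by left.
  by right; move: xw; rewrite h0// in_itv/= andbT => ->.
case=> [[]//|]; case: ifPn => // x0 Dw.
by rewrite h0// in_itv/= andbT.
Unshelve. all: by end_near. Qed.

Lemma normcE (z : R[i]) : `|z| = (normc z)%:C.
Proof. by []. Qed.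

Lemma normc_distD (a b : R[i]) : `|normc a - normc b| <= normc (a - b).
Proof.
have ab := le_normcD (a - b) b; have ba := le_normcD (b - a) a.
rewrite !subrK in ab ba; rewrite -[b - a]opprB normcN in ba.
by rewrite ler_norml; apply/andP; split; lra.
Qed.


Lemma normc_le (a b : R) : normc (a +i* b) <= `|a| + `|b|.
Proof.
rewrite /normc -[leRHS]ger0_norm ?addr_ge0// -sqrtr_sqr ler_wsqrtr//.
rewrite -[a ^+ 2]real_normK ?num_real// -[b ^+ 2]real_normK ?num_real//.
by have := mulr_ge0 (normr_ge0 a) (normr_ge0 b); nra.
Qed.

Lemma continuous_toC : continuous (fun w : R * R => (w.1 +i* w.2 : R[i]^o)).
Proof.
move=> w; apply/cvgrPdist_lt => e e0.
have eE : e = (complex.Re e)%:C by rewrite RRe_real// gtr0_real.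
move: e0; rewrite eE ltcR => e0.
have e2 : 0 < complex.Re e / 2 by rewrite divr_gt0.
exists (ball w.1 (complex.Re e / 2), ball w.2 (complex.Re e / 2)) => /=.
  by split; exact: nbhsx_ballx.
move=> [a b] [/=]; rewrite -!ball_normE/= => wa wb.
rewrite normcE ltcR (le_lt_trans (normc_le _ _))//=.
by rewrite (splitr (complex.Re e)) ltrD.
Qed.

Lemma continuous_normc (f : R[i] -> R[i]) (w : R * R) :
  {for (w.1 +i* w.2), continuous (f : R[i]^o -> R[i]^o)} ->
  {for w, continuous (fun w => normc (f (w.1 +i* w.2)))}.
Proof.
move=> cf.
have : {for w, continuous ((f : R[i]^o -> R[i]^o) \o (fun w : R * R => (w.1 +i* w.2 : R[i]^o)))}.
  by apply: continuous_comp; [exact: continuous_toC|exact: cf].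
move=> /cvgrPdist_lt cfw; apply/cvgrPdist_lt => e e0.
have /cfw : 0 < e%:C by rewrite ltcR.
apply: filterS => u; rewrite /= normcE ltcR.
by apply: le_lt_trans; exact: normc_distD.
Qed.


Lemma analytic_continuous f z : analytic_disc f -> `|z| < 1 ->
  {for z, continuous (f : R[i]^o -> R[i]^o)}.
Proof.
move=> [df _] /df /derivable1_diffP dfz; exact: differentiable_continuous.
Qed.

Lemma unit_discE w : unit_disc w -> `|w.1 +i* w.2| < 1.
Proof. by rewrite normcE (ltcR _ 1). Qed.

Lemma unit_discN w : ~ unit_disc w -> ~ `|w.1 +i* w.2| < 1.
Proof. by rewrite normcE (ltcR _ 1). Qed.

Lemma continuous_normc_toC :
  continuous (fun w : R * R => normc (w.1 +i* w.2)).
Proof. by move=> w; apply: (@continuous_normc id) => /= y; exact: cvg_id. Qed.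

Lemma open_unit_disc : open unit_disc.
Proof.
have /continuousP h := continuous_normc_toC.
by apply: (h [set x | x < 1]); exact: open_lt.
Qed.

Lemma measurable_unit_disc :
  measurable (unit_disc : set (measurableTypeR R * measurableTypeR R)).
Proof. exact: open_prod_measurable open_unit_disc. Qed.

Lemma measurable_modulus f : analytic_disc f ->
  measurable_fun [set: measurableTypeR R * measurableTypeR R]
    ((fun w => normc (f (w.1 +i* w.2))) : _ -> measurableTypeR R).
Proof.
move=> af; apply: (continuous_disc_measurable open_unit_disc) => w wD.
  by apply: continuous_normc; exact/analytic_continuous/unit_discE.
by rewrite (proj2 af) ?normc0//; exact: unit_discN.
Qed.

Lemma measurable_weight mu :
  measurable_fun [set: measurableTypeR R * measurableTypeR R]
    ((fun w => (1 - normc (w.1 +i* w.2)) `^ mu) : _ -> measurableTypeR R).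
Proof.
apply: (@measurableT_comp _ _ _ _ _ _ (@powR R ^~ mu)) => //.
apply: measurable_funB => //.
apply: (continuous_disc_measurable (D := setT)) => //; first exact: openT.
  by move=> w _; exact: continuous_normc_toC.
by move=> w /(_ Logic.I).
Qed.

Local Notation leb2 := (@lebesgue_measure R \x @lebesgue_measure R)%E.

Let dens p mu f (w : measurableTypeR R * measurableTypeR R) : R :=
  normc (f (w.1 +i* w.2)) `^ p * (1 - normc (w.1 +i* w.2)) `^ mu.

Let wfun p mu f (w : measurableTypeR R * measurableTypeR R) : R :=
  normc (f (w.1 +i* w.2)) * (1 - normc (w.1 +i* w.2)) `^ (mu / p).

Let normc_ge0 z : 0 <= normc z.
Proof. by case: z => a b; exact: sqrtr_ge0. Qed.

Let dens_ge0 p mu f w : 0 <= dens p mu f w.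
Proof. by rewrite mulr_ge0// powR_ge0. Qed.

Let measurable_dens p mu f : analytic_disc f ->
  measurable_fun setT (dens p mu f).
Proof.
move=> af; apply: measurable_funM; last exact: measurable_weight.
apply: (@measurableT_comp _ _ _ _ _ _ (@powR R ^~ p)) => //.
exact: measurable_modulus.
Qed.

Let measurable_wfun p mu f : analytic_disc f ->
  measurable_fun setT (wfun p mu f).
Proof.
move=> af; apply: measurable_funM; last exact: measurable_weight.
exact: measurable_modulus.
Qed.

Let wfun_ge0 p mu f w : 0 <= wfun p mu f w.
Proof. by rewrite mulr_ge0// powR_ge0. Qed.

Let wfunE p mu f w : 0 < p -> (wfun p mu f w) `^ p = dens p mu f w.
Proof.
move=> p0; rewrite powRM ?powR_ge0// -powRrM divfK// gt_eqF//.
Qed.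

Let bergman_intT p mu f : 0 < p -> analytic_disc f -> bergman_int p mu f =
  ((pi^-1)%:E * \int[leb2]_w (dens p mu f w)%:E)%E.
Proof.
move=> p0 af; rewrite /bergman_int integral_mkcond; congr (_ * _)%E.
apply: eq_integral => w _; rewrite patchE; case: ifPn => //.
rewrite notin_setE => /unit_discN /(proj2 af) fw.
by rewrite /dens fw normc0 powR0 ?gt_eqF// mul0r.
Qed.

Let wfun_Lnorm p mu f : 0 < p ->
  (Lnorm leb2 p%:E (EFin \o wfun p mu f) =
  (\int[leb2]_w (dens p mu f w)%:E) `^ p^-1)%E.
Proof.
move=> p0; rewrite unlock; congr (_ `^ _)%E; apply: eq_integral => w _ /=.
by rewrite -wfunE// ger0_norm.
Qed.

Let pi_inv_gt0 : 0 < (pi : R)^-1. Proof. by rewrite invr_gt0 pi_gt0. Qed.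

Let dens_int_ge0 p mu f : (0 <= \int[leb2]_w (dens p mu f w)%:E)%E.
Proof. by apply: integral_ge0 => w _; rewrite lee_fin. Qed.

Lemma bergman_int_ge0 p mu f : (0 <= bergman_int p mu f)%E.
Proof.
rewrite /bergman_int mule_ge0 ?lee_fin ?(ltW pi_inv_gt0)//.
by apply: integral_ge0 => w _; rewrite lee_fin dens_ge0.
Qed.

Let bergman_int_fin p mu f : 0 < p -> analytic_disc f ->
  (bergman_int p mu f < +oo)%E <->
  (Lnorm leb2 p%:E (EFin \o wfun p mu f) < +oo)%E.
Proof.
move=> p0 af; rewrite bergman_intT// wfun_Lnorm//; split.
  move=> h; apply: poweR_lty; move: h; rewrite !ltey.
  by apply: contra_neq => ->; rewrite gt0_muley// lte_fin.
move=> /lty_poweRy h; rewrite lte_mul_pinfty// ?lee_fin ?ltW//; apply: h.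
by rewrite invr_neq0// gt_eqF.
Qed.

Let bergman_norm_Lnorm p mu f : 0 < p -> analytic_disc f ->
  (bergman_int p mu f < +oo)%E ->
  bergman_norm p mu f =
    (pi^-1) `^ p^-1 * fine (Lnorm leb2 p%:E (EFin \o wfun p mu f)).
Proof.
move=> p0 af; rewrite /bergman_norm bergman_intT// wfun_Lnorm//.
have := dens_int_ge0 p mu f.
case: (\int[leb2]_w _)%E => [r| |]//=; rewrite ?lee_fin => r0 h.
  by rewrite -powRM// ltW.
by move: h; rewrite gt0_muley// lte_fin.
Qed.


Lemma analytic_disc0 : analytic_disc 0.
Proof. by split => // z _; exact: derivable_cst. Qed.

Lemma analytic_discD f g :
  analytic_disc f -> analytic_disc g -> analytic_disc (f + g).
Proof.
move=> [df f0] [dg g0]; split => z z1.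
  by apply: derivableD; [exact: df|exact: dg].
by have -> : (f + g) z = f z + g z by []; rewrite f0// g0// addr0.
Qed.

Lemma analytic_discZ c f : analytic_disc f -> analytic_disc (c *: f).
Proof.
move=> [df f0]; split => z z1; first by apply: derivableZ; exact: df.
by have -> : (c *: f) z = c * f z by []; rewrite f0// mulr0.
Qed.

Let lnormD p mu f g : 1 < p -> analytic_disc f -> analytic_disc g ->
  (Lnorm leb2 p%:E (EFin \o wfun p mu (f + g)%R) <=
   Lnorm leb2 p%:E (EFin \o wfun p mu f) +
   Lnorm leb2 p%:E (EFin \o wfun p mu g))%E.
Proof.
move=> p1 af ag.
apply: le_trans (minkowski_EFin leb2 (measurable_wfun _ _ af)
  (measurable_wfun _ _ ag) (ltW p1)).
have p0 : 0 < p by exact: lt_trans p1.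
have mD := measurable_wfun p mu (analytic_discD af ag).
have fgD : measurable_fun setT (wfun p mu f \+ wfun p mu g).
  by apply: measurable_funD; exact: measurable_wfun.
have le_fg w : `|wfun p mu (f + g) w| `^ p <= `|wfun p mu f w + wfun p mu g w| `^ p.
  rewrite ge0_ler_powR ?nnegrE ?(ltW p0)//.
  rewrite !ger0_norm ?addr_ge0// -mulrDl ler_wpM2r ?powR_ge0//.
  exact: le_normcD.
have itv0y (h : measurableTypeR R * measurableTypeR R -> R) :
    (\int[leb2]_w (`|h w| `^ p)%:E)%E \in `[0%E, +oo%E].
  rewrite in_itv/= leey andbT.
  by apply: integral_ge0 => w _; rewrite lee_fin powR_ge0.
rewrite unlock; apply: gt0_ler_poweR;
  [by rewrite invr_ge0 ltW|exact: itv0y|exact: itv0y|].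
apply: ge0_le_integral => //=.
- apply/measurable_EFinP.
  apply: (@measurableT_comp _ _ _ _ _ _ (@powR R ^~ p)) => //.
  exact: measurableT_comp.
- apply/measurable_EFinP.
  apply: (@measurableT_comp _ _ _ _ _ _ (@powR R ^~ p)) => //.
  exact: measurableT_comp.
by move=> w _; rewrite lee_fin.
Qed.

Lemma bergmanD p mu f g : 1 < p ->
  bergman p mu f -> bergman p mu g -> bergman p mu (f + g).
Proof.
move=> p1 [af If] [ag Ig]; have p0 : 0 < p by exact: lt_trans p1.
have afg := analytic_discD af ag; split; first exact: afg.
apply/(bergman_int_fin mu p0 afg).
apply: le_lt_trans (lnormD mu p1 af ag) _.
by apply: lte_add_pinfty; apply/(bergman_int_fin mu p0).
Qed.

Lemma bergman_normD p mu f g : 1 < p ->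
  bergman p mu f -> bergman p mu g ->
  bergman_norm p mu (f + g) <= bergman_norm p mu f + bergman_norm p mu g.
Proof.
move=> p1 bf bg; have p0 : 0 < p by exact: lt_trans p1.
have [afg Ifg] := bergmanD p1 bf bg; move: bf bg => [af If] [ag Ig].
rewrite !bergman_norm_Lnorm// -mulrDr ler_wpM2l ?powR_ge0//.
move: If Ig Ifg => /bergman_int_fin-/(_ p0 af) If /bergman_int_fin-/(_ p0 ag) Ig
  /bergman_int_fin-/(_ p0 afg) Ifg.
rewrite -fineD ?ge0_fin_numE ?Lnorm_ge0// fine_le ?ge0_fin_numE ?adde_ge0 ?Lnorm_ge0//.
  by rewrite lte_add_pinfty.
exact: lnormD.
Qed.

Lemma bergman_intZ p mu c f : 0 < p -> analytic_disc f ->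
  bergman_int p mu (c *: f) = ((normc c `^ p)%:E * bergman_int p mu f)%E.
Proof.
move=> p0 af; rewrite !bergman_intT//; last exact: analytic_discZ.
rewrite muleCA; congr (_ * _)%E.
have md : measurable_fun setT (EFin \o dens p mu f).
  by apply/measurable_EFinP; exact: measurable_dens.
have dens0 w : setT w -> (0 <= (EFin \o dens p mu f) w)%E.
  by rewrite /= lee_fin.
have c0 : (0 <= (normc c `^ p)%:E)%E by rewrite lee_fin powR_ge0.
rewrite -(ge0_integralZl leb2 measurableT md dens0 c0).
apply: eq_integral => w _.
rewrite -EFinM; congr (_%:E); rewrite /dens mulrA; congr (_ * _).
by rewrite -powRM// -normcM.
Qed.

Lemma bergmanZ p mu c f : 0 < p ->
  bergman p mu f -> bergman p mu (c *: f).
Proof.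
move=> p0 [af If]; split; first exact: analytic_discZ.
by rewrite bergman_intZ// lte_mul_pinfty// ?lee_fin ?powR_ge0.
Qed.

Lemma bergman_normZ p mu c f : 0 < p -> bergman p mu f ->
  bergman_norm p mu (c *: f) = normc c * bergman_norm p mu f.
Proof.
move=> p0 [af If]; rewrite /bergman_norm bergman_intZ// fineM//; last first.
  by rewrite ge0_fin_numE ?bergman_int_ge0.
rewrite powRM ?powR_ge0 ?fine_ge0 ?bergman_int_ge0//.
by rewrite -powRrM divff ?gt_eqF// powRr1.
Qed.

Lemma bergman_norm_ge0 p mu f : 0 <= bergman_norm p mu f.
Proof. exact: powR_ge0. Qed.

Lemma bergman0 p mu : 0 < p -> bergman p mu 0.
Proof.
move=> p0; split; first exact: analytic_disc0.
rewrite (_ : 0 = 0 *: 0); last by rewrite scaler0.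
rewrite bergman_intZ ?normc0 ?powR0 ?gt_eqF ?mul0e//.
Qed.

Lemma sub_bergman p mu1 mu2 : 0 < p -> mu1 <= mu2 ->
  bergman p mu1 `<=` bergman p mu2.
Proof.
move=> p0 mu12 f [af If]; split; [exact: af|apply: le_lt_trans If].
rewrite /bergman_int lee_wpmul2l ?lee_fin ?(ltW pi_inv_gt0)//.
apply: ge0_le_integral => //.
- exact: measurable_unit_disc.
- by move=> w _; rewrite lee_fin dens_ge0.
- apply/measurable_EFinP; apply: measurable_funS (measurable_dens p mu2 af) => //.
- apply/measurable_EFinP; apply: measurable_funS (measurable_dens p mu1 af) => //.
move=> w w1; rewrite lee_fin ler_wpM2l ?powR_ge0// ger_powR//.
by rewrite subr_gt0 w1/= gerBl.
Qed.

End Bergman.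

Section BergmanSpaces.
Context (R : realType) (p : R) (p1 : 1 < p) (alpha : R).

Let p0 : 0 < p. Proof. exact: lt_trans p1. Qed.

Definition bergman_plus_set : set (R[i] -> R[i]) :=
  \bigcap_(mu in [set mu | alpha < mu]) bergman p mu.

Lemma bergman_plus_closed :
  submod_closed [pred f | f \in bergman_plus_set].
Proof.
apply: submod_closed_set => [mu _|a f g bf bg mu amu]; first exact: bergman0.
exact: (bergmanD p1 (bergmanZ a p0 (bf mu amu)) (bg mu amu)).
Qed.

Definition bergman_plus_submod := Submod bergman_plus_closed.

Let normcD_lt (x y eps : R) (a b : R[i]) : 0 <= x -> 0 <= y ->
  x < eps -> y < eps -> `|a| + `|b| <= 1 -> normc a * x + normc b * y < eps.
Proof.
rewrite !normcE -rmorphD/= (lecR _ 1) => x0 y0 xe ye ab.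
have a0 : 0 <= normc a by case: (a) => ? ?; exact: sqrtr_ge0.
have b0 : 0 <= normc b by case: (b) => ? ?; exact: sqrtr_ge0.
have h : Num.max x y < eps by rewrite gt_max xe.
apply: le_lt_trans h.
have xm : x <= Num.max x y by rewrite le_max lexx.
have ym : y <= Num.max x y by rewrite le_max lexx orbT.
by have := ler_wpM2l a0 xm; have := ler_wpM2l b0 ym; nra.
Qed.

Let normcR (r : R) : 0 < r -> normc r%:C = r.
Proof.
move=> r0; apply: complexI; rewrite -normcE gtr0_norm//.
by rewrite (ltcR 0).
Qed.

Let posC (r : R[i]) : 0 < r -> exists2 s : R, 0 < s & r = s%:C.
Proof.
move=> r0; have rE : r = (complex.Re r)%:C by rewrite RRe_real// gtr0_real.
by exists (complex.Re r) => //; move: r0; rewrite {1}rE (ltcR 0).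
Qed.

Section Plus.
Local Notation V := (subspace_of bergman_plus_submod).

Let valP_plus (f : V) n : bergman p (alpha + n.+1%:R^-1) (val f).
Proof.
case: f => f /= /[!inE] bf; apply: bf => /=.
by rewrite ltrDl invr_gt0 ltr0n.
Qed.

(* The semi-balls of the increasing sequence of norms with weights
   alpha + 1, alpha + 1/2, alpha + 1/3, and so on. *)
Definition bergman_plus_ball (N : nat) (eps : R) : set V :=
  [set f | forall n, (n <= N)%N ->
     bergman_norm p (alpha + n.+1%:R^-1) (val f) < eps].

Definition bergman_plus_nbhs0 : set (set V) :=
  [set U | exists N, exists2 eps : R, 0 < eps & U = bergman_plus_ball N eps].

Let plus_nonempty : exists U, bergman_plus_nbhs0 U.
Proof. by exists (bergman_plus_ball 0 1), 0%N, 1. Qed.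

Let plus_setI U W : bergman_plus_nbhs0 U -> bergman_plus_nbhs0 W ->
  exists2 Z, bergman_plus_nbhs0 Z & Z `<=` U `&` W.
Proof.
move=> [N [e e0 ->]] [M [d d0 ->]].
exists (bergman_plus_ball (maxn N M) (Num.min e d)).
  by exists (maxn N M), (Num.min e d) => //; rewrite lt_min e0.
move=> f fN; split => n nN.
  have := fN n; rewrite leq_max nN => /(_ isT).
  by rewrite lt_min => /andP[].
have := fN n; rewrite leq_max nN orbT => /(_ isT).
by rewrite lt_min => /andP[].
Qed.

Let plus_scale U (r : R[i]) : bergman_plus_nbhs0 U -> 0 < r ->
  exists2 W, bergman_plus_nbhs0 W & forall x, W x -> U (r *: x).
Proof.
move=> [N [e e0 ->]] /posC[s s0 ->].
exists (bergman_plus_ball N (e / s)).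
  by exists N, (e / s) => //; rewrite divr_gt0.
move=> f fN n nN; rewrite /= (bergman_normZ _ p0 (valP_plus f n)).
by rewrite normcR// mulrC -ltr_pdivlMr//; exact: fN.
Qed.

Let plus_absconvex U : bergman_plus_nbhs0 U -> absconvex U.
Proof.
move=> [N [e e0 ->]] f g a b fN gN ab n nN /=.
have ba := bergmanZ a p0 (valP_plus f n).
have bb := bergmanZ b p0 (valP_plus g n).
apply: le_lt_trans (bergman_normD p1 ba bb) _.
rewrite (bergman_normZ _ p0 (valP_plus f n)).
rewrite (bergman_normZ _ p0 (valP_plus g n)).
by apply: normcD_lt; rewrite ?bergman_norm_ge0//; [exact: fN|exact: gN].
Qed.

Let plus_absorbing U f : bergman_plus_nbhs0 U ->
  exists2 r : R[i], 0 < r & U (r *: f).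
Proof.
move=> [N [e e0 ->]].
pose S := \sum_(n < N.+1) bergman_norm p (alpha + n.+1%:R^-1) (val f).
have S0 : 0 <= S by apply: sumr_ge0 => n _; exact: bergman_norm_ge0.
have r0 : 0 < e / (1 + S) by rewrite divr_gt0// ltr_wpDr.
exists (e / (1 + S))%:C; first by rewrite (ltcR 0).
move=> n nN; rewrite /= (bergman_normZ _ p0 (valP_plus f n)) normcR//.
rewrite mulrAC ltr_pdivrMr ?ltr_wpDr// ltr_pM2l//.
rewrite (@le_lt_trans _ _ S)// ?ltrDr// /S.
rewrite (bigD1 (Ordinal (nN : (n < N.+1)%N)))//= lerDl.
by apply: sumr_ge0 => ? _; exact: bergman_norm_ge0.
Qed.

Definition bergman_plus_base : lc_base V :=
  LcBase plus_nonempty plus_setI plus_scale plus_absconvex plus_absorbing.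

Definition bergman_plus : tvsType (R[i] : numFieldType) :=
  lc_space bergman_plus_base.

End Plus.

Section Minus.
Hypothesis alpha0 : 0 < alpha.

Definition bergman_minus_set : set (R[i] -> R[i]) :=
  \bigcup_(mu in [set mu | 0 < mu < alpha]) bergman p mu.

Lemma bergman_minus_closed :
  submod_closed [pred f | f \in bergman_minus_set].
Proof.
apply: submod_closed_set.
  exists (alpha / 2); last exact: bergman0.
  by rewrite /= divr_gt0//= ltr_pdivrMr// mulr_natr mulr2n ltrDl.
move=> a f g [m /= /andP[m0 ma] bf] [k /= /andP[k0 ka] bg].
exists (Num.max m k); first by rewrite /= lt_max m0/= gt_max ma.
have mM : m <= Num.max m k by rewrite le_max lexx.
have kM : k <= Num.max m k by rewrite le_max lexx orbT.
exact: (bergmanD p1 (bergmanZ a p0 (sub_bergman p0 mM bf))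
  (sub_bergman p0 kM bg)).
Qed.

Definition bergman_minus_submod := Submod bergman_minus_closed.

Local Notation V := (subspace_of bergman_minus_submod).

(* The absolutely convex sets whose trace on each step A^p_mu is a
   neighbourhood of 0 for the norm of A^p_mu: a base of 0-neighbourhoods of the
   locally convex inductive limit (see bergman_minus_incl_continuous and
   bergman_minus_universal for its universal property). *)
Definition bergman_minus_nbhs0 : set (set V) :=
  [set U | absconvex U /\
     forall mu, 0 < mu < alpha -> exists2 d : R, 0 < d &
       forall f : V, bergman p mu (val f) -> bergman_norm p mu (val f) < d ->
         U f].

Let minus_nonempty : exists U, bergman_minus_nbhs0 U.
Proof. by exists setT; split => // mu _; exists 1. Qed.

Let minus_setI U W : bergman_minus_nbhs0 U -> bergman_minus_nbhs0 W ->
  exists2 Z, bergman_minus_nbhs0 Z & Z `<=` U `&` W.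
Proof.
move=> [aU nU] [aW nW]; exists (U `&` W) => //; split.
  by move=> x y a b [Ux Wx] [Uy Wy] ab; split; [exact: aU|exact: aW].
move=> mu m; have [d d0 dU] := nU _ m; have [e e0 eW] := nW _ m.
exists (Num.min d e); first by rewrite lt_min d0.
by move=> f bf; rewrite lt_min => /andP[fd fe]; split; [exact: dU|exact: eW].
Qed.

Let minus_scale U (r : R[i]) : bergman_minus_nbhs0 U -> 0 < r ->
  exists2 W, bergman_minus_nbhs0 W & forall x, W x -> U (r *: x).
Proof.
move=> [aU nU] /posC[s s0 ->]; exists [set f | U (s%:C *: f)] => //; split.
  move=> x y a b /= Ux Uy ab; rewrite scalerDr !scalerA ![s%:C * _]mulrC.
  by rewrite -!scalerA; exact: aU.
move=> mu m; have [d d0 dU] := nU _ m; exists (d / s).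
  by rewrite divr_gt0.
move=> f bf fd; apply: dU; first exact: bergmanZ.
by rewrite bergman_normZ// normcR// mulrC -ltr_pdivlMr.
Qed.

Let minus_absconvex U : bergman_minus_nbhs0 U -> absconvex U.
Proof. by case. Qed.

Let minus_absorbing U f : bergman_minus_nbhs0 U ->
  exists2 r : R[i], 0 < r & U (r *: f).
Proof.
move=> [aU nU]; have : val f \in bergman_minus_set by exact: (valP f).
rewrite inE => -[mu m bf]; have [d d0 dU] := nU _ m.
set s := bergman_norm p mu (val f).
have s0 : 0 <= s by exact: bergman_norm_ge0.
have r0 : 0 < d / (1 + s) by rewrite divr_gt0// ltr_wpDr.
exists (d / (1 + s))%:C; first by rewrite (ltcR 0).
apply: dU; first exact: bergmanZ.
rewrite bergman_normZ// normcR// -/s.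
by rewrite mulrAC ltr_pdivrMr ?ltr_wpDr// ltr_pM2l// ltrDr.
Qed.

Definition bergman_minus_base : lc_base V :=
  LcBase minus_nonempty minus_setI minus_scale minus_absconvex minus_absorbing.

Definition bergman_minus : tvsType (R[i] : numFieldType) :=
  lc_space bergman_minus_base.

Lemma bergman_minus_incl_continuous mu (W : set bergman_minus) :
  0 < mu < alpha -> nbhs 0 W ->
  exists2 d : R, 0 < d & forall f : V, bergman p mu (val f) ->
    bergman_norm p mu (val f) < d -> W f.
Proof.
move=> m [U [aU nU] UW]; have [d d0 dU] := nU _ m.
exists d => // f bf fd; rewrite -[f]add0r.
by apply: UW; exact: dU.
Qed.

Lemma bergman_minus_universal (F : tvsType R[i])
  (T : {linear bergman_minus -> F}) :
  (forall mu (W : set F), 0 < mu < alpha -> nbhs 0 W ->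
     exists2 d : R, 0 < d & forall f : V, bergman p mu (val f) ->
       bergman_norm p mu (val f) < d -> W (T f)) ->
  continuous T.
Proof.
move=> hT f W WTf.
have [D cD [oD bD]] := @locally_convex _ F.
have : \forall v \near (0 : F), W (T f + v).
  have : (fun v : F => T f + v) @ (0 : F) --> T f + 0.
    by apply: (@continuous_comp _ _ _ (fun v : F => (T f, v)) (fun x => x.1 + x.2));
      [apply: cvg_pair => /=; [exact: cvg_cst|exact: cvg_id]|exact: add_continuous].
  by rewrite addr0; apply.
move=> /bD[C [DC C0]] CW.
have cC (s : R[i]) x y : 0 <= s -> s <= 1 -> C x -> C y ->
    C (s *: x + (1 - s) *: y).
  move=> s0 s1 Cx Cy.
  have /(_ x y (Itv01 s0 s1)) := cD C (mem_set DC).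
  by rewrite !inE; exact.
pose U : set V := [set g | forall c : R[i], `|c| <= 1 -> C (T (c *: g))].
exists U => [|u /(_ 1)]; last first.
  by rewrite normr1 scale1r => /(_ (lexx _)) /CW; rewrite -linearD.
split; last first.
  move=> mu m.
  have nC : nbhs (0 : F) C by apply: open_nbhs_nbhs; split => //; exact: oD.
  have [d d0 dC] := hT mu C m nC; exists d => // g bg gd c c1.
  apply: dC; first exact: bergmanZ.
  rewrite (bergman_normZ _ p0 bg) (le_lt_trans _ gd)//.
  by rewrite ler_piMl ?bergman_norm_ge0// -(lecR _ 1).
have C0' x (s : R[i]) : 0 <= s -> s <= 1 -> C x -> C (s *: x).
  move=> s0 s1 Cx; rewrite -[_ *: x]addr0 -[X in _ + X](scaler0 _ (1 - s)).
  exact: cC.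
have normu (c : R[i]) : exists2 e : R[i], `|e| <= 1 & c = `|c| * e.
  have [->|c0] := eqVneq c 0; first by exists 0; rewrite ?normr0 ?mul0r.
  exists (c / `|c|); last by rewrite mulrC divfK// normr_eq0.
  by rewrite normf_div normr_id divff// normr_eq0.
move=> x y a b Ux Uy ab c c1.
have [u u1 aE] := normu a; have [v v1 bE] := normu b.
set s := `|a| + `|b| in ab.
have s0 : 0 <= s by rewrite addr_ge0.
have cu (w : R[i]) : `|w| <= 1 -> `|c * w| <= 1.
  by move=> w1; rewrite normrM -[leRHS]mulr1 ler_pM.
have [sz|sn0] := eqVneq s 0.
  move: sz => /eqP; rewrite paddr_eq0// !normr_eq0 => /andP[/eqP-> /eqP->].
  by rewrite !scale0r addr0 scaler0 linear0.
have -> : T (c *: (a *: x + b *: y)) =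
    s *: ((`|a| / s) *: T ((c * u) *: x) + (1 - `|a| / s) *: T ((c * v) *: y)).
  have -> : 1 - `|a| / s = `|b| / s.
    by rewrite -(divff sn0) -mulrBl /s addrC addKr.
  rewrite [RHS]scalerDr !scalerA [s * _]mulrC [s * (`|b| / s)]mulrC !divfK//.
  rewrite !linearD !linearZ/= !scalerA {1}aE {1}bE.
  by rewrite !mulrA (mulrAC c `|a|) (mulrAC c `|b|).
apply: C0' => //; apply: cC; [by rewrite divr_ge0| |exact/Ux/cu|exact/Uy/cu].
by rewrite ler_pdivrMr ?mul1r ?lerDl// lt_neqAle eq_sym sn0.
Qed.

End Minus.

End BergmanSpaces.

Section Nuclear.
Context (K : numFieldType).

Definition continuous_seminorm (E : tvsType K) (q : E -> K) :=
  [/\ forall x, 0 <= q x,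
      forall x y, q (x + y) <= q x + q y,
      forall a x, q (a *: x) = `|a| * q x &
      continuous (q : E -> K^o)].

(* X is the completion of E / q^-1(0) for the norm induced by q, with canonical
   map j; it is unique up to isometric isomorphism. *)
Definition local_banach (E : tvsType K) (q : E -> K)
    (X : completeNormedModType K) (j : {linear E -> X}) :=
  (forall x, `|j x| = q x) /\ dense (range j).

Definition nuclear_map (X Y : completeNormedModType K) (T : X -> Y) :=
  exists (l : K^nat) (a : nat -> {linear X -> K^o}) (y : Y^nat),
    [/\ cvgn (series (fun n => `|l n| : K^o)),
        forall n x, `|a n x| <= `|x|,
        forall n, `|y n| <= 1 &
        forall x, series (fun n => (l n * a n x) *: y n) @ \oo --> T x].

(* T is the canonical map between the local Banach spaces of r and q. *)
Definition nuclear_space (E : tvsType K) :=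
  forall q : E -> K, continuous_seminorm q ->
  exists r : E -> K, [/\ continuous_seminorm r, (forall x, q x <= r x) &
    exists (X Y : completeNormedModType K)
      (jX : {linear E -> X}) (jY : {linear E -> Y}) (T : {linear X -> Y}),
      [/\ local_banach r jX, local_banach q jY,
          (forall x, T (jX x) = jY x) & nuclear_map T]].

End Nuclear.

(* Main.v *)
Require Import Defs.
From mathcomp Require Import all_boot all_order all_algebra.
From mathcomp Require Import all_classical all_reals all_analysis.
From mathcomp Require Import measurable_realfun complex ring lra.
Import Order.TTheory GRing.Theory Num.Theory.
Import numFieldNormedType.Exports ComplexField.Normc.

(* Nuclearity would make the canonical map between two local Banach spaces
   absolutely summing: for every continuous seminorm q there are a continuous
   seminorm r and C with
     \sum_i q (x_i) <= C * sup_{|c_i| <= 1} r (\sum_i c_i x_i).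
   We violate this with N atoms x_i z = (1 + N (1 - conj zeta_i * z))^(-s)
   attached to points zeta_i of the unit circle with ordinates i/N.  Each atom
   has size about 1 on a square of side 1/N at distance about 1/N from the
   circle, so its norm with weight mu is at least of order N^(-(2 + mu)/p).  The
   atoms are nearly disjoint (\sum_i |x_i| is bounded independently of N), so
   \sum_i c_i x_i has norm with weight m at most of order N^(-(1 + m)/p).  For
   large N this contradicts summability as soon as mu - m < p - 1, which leaves
   room for suitable weights since 1 < p. *)

Set Implicit Arguments.
Unset Strict Implicit.
Unset Printing Implicit Defensive.

Local Open Scope classical_set_scope.
Local Open Scope ring_scope.

(** * Nuclear maps are absolutely summing *)

Section NuclearSumming.
Context (K : numFieldType).

Lemma cvg_series_norm_bounded (l : K^nat) :
  cvgn (series (fun n => `|l n| : K^o)) ->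
  exists2 C, 0 <= C & forall k, \sum_(n < k) `|l n| <= C.
Proof.
move=> /cvg_seq_bounded [M [Mr hM]].
have M1 : M < `|M| + 1 by rewrite (le_lt_trans (real_ler_norm Mr))// ltrDl.
exists (`|M| + 1) => [|k]; first by rewrite addr_ge0.
have := hM _ M1 k Logic.I; rewrite /series /= big_mkord.
by rewrite ger0_norm// sumr_ge0.
Qed.

(* A nuclear map is absolutely summing: its nuclear representation bounds the
   norm of [T x] by [\sum_n |l n| |a n x|]. *)
Lemma nuclear_map_summing (X Y : completeNormedModType K)
    (T : {linear X -> Y}) : nuclear_map T ->
  exists2 C : K, 0 <= C &
    forall (m : nat) (x : 'I_m -> X) (B : K),
      (forall c : 'I_m -> K, (forall i, `|c i| <= 1) ->
         `|\sum_i c i *: x i| <= B) ->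
      \sum_i `|T (x i)| <= C * B.
Proof.
move=> [l [a [y [cl a1 y1 cT]]]].
have [C C0 hC] := cvg_series_norm_bounded cl.
exists C => // m x B hB.
have B0 : 0 <= B.
  by apply: le_trans (hB (fun=> 0) _) => // i; rewrite normr0.
have aB n : \sum_i `|a n (x i)| <= B.
  (* The phases satisfy [c i * a n (x i) = |a n (x i)|], so the sum of moduli is the value of [a n]
     at a single combination, of norm at most [B]. The phase is 0 where [a n (x i)] vanishes. *)
  pose c i := if a n (x i) == 0 then 0 else `|a n (x i)| / a n (x i).
  have c1 i : `|c i| <= 1.
    rewrite /c; case: ifPn => [_|a0]; first by rewrite normr0.
    by rewrite normf_div normr_id divff ?normr_eq0.
  apply: le_trans (hB c c1); apply: le_trans (a1 n _).
  rewrite linear_sum/= (_ : \sum_i a n (c i *: x i) = \sum_i `|a n (x i)|).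
    by rewrite ger0_norm// sumr_ge0.
  apply: eq_bigr => i _; rewrite linearZ/= /c.
  case: ifPn => [/eqP ->|a0]; first by rewrite scale0r normr0.
  by rewrite -[_ *: _]/(_ * _) divfK.
have partial k : \sum_i `|series (fun n => (l n * a n (x i)) *: y n) k|
    <= C * B.
  apply: (@le_trans _ _ (\sum_i \sum_(n < k) `|l n| * `|a n (x i)|)).
    apply: ler_sum => i _; rewrite /series/= big_mkord.
    apply: le_trans (ler_norm_sum _ _ _) _.
    apply: ler_sum => n _; rewrite normrZ normrM.
    by rewrite -[leRHS]mulr1 ler_wpM2l.
  rewrite exchange_big/=.
  apply: (@le_trans _ _ (\sum_(n < k) `|l n| * B)).
    by apply: ler_sum => n _; rewrite -mulr_sumr ler_wpM2l.
  by rewrite -mulr_suml ler_wpM2r.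
(* The bound passes to the limit by contradiction; the order of [K] is partial, so negating [<=]
   needs both sides real. If the excess [d] were positive, approximating each of the m vectors
   within d / (m + 1) would cost at most d m / (m + 1) < d in total. Using [m.+1] also covers m =
   0. *)
have sumr_real : \sum_i `|T (x i)| \is Num.real.
  by rewrite ger0_real// sumr_ge0.
have CBr : C * B \is Num.real by rewrite ger0_real// mulr_ge0.
rewrite real_leNgt//; apply/negP => lt.
set d := \sum_i `|T (x i)| - C * B.
have d0 : 0 < d by rewrite subr_gt0.
have e0 : 0 < d / m.+1%:R by rewrite divr_gt0.
have : \forall k \near \oo, forall i,
    `|T (x i) - series (fun n => (l n * a n (x i)) *: y n) k| < d / m.+1%:R.
  apply: filter_forall => i.
  by have /cvgrPdist_lt/(_ _ e0) := cT (x i).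
move=> [k0 _ /(_ k0 (leqnn _)) hk].
have : \sum_i `|T (x i)| <=
    \sum_i (d / m.+1%:R + `|series (fun n => (l n * a n (x i)) *: y n) k0|).
  apply: ler_sum => i _.
  set s := series _ _.
  by rewrite -[T (x i)](subrK s) (le_trans (ler_normD _ _))// lerD2r ltW.
rewrite big_split/= => /le_trans/(_ (lerD (lexx _) (partial k0))).
rewrite -lerBlDr -/d sumr_const card_ord -[X in _ <= X]mulr_natr => h.
have : d * m.+1%:R <= d * m%:R.
  by rewrite -ler_pdivlMr ?ltr0Sn// mulrAC.
by rewrite ler_pM2l// ler_nat ltnn.
Qed.

(** By linearity of [jX], the hypothesis on [r] is a norm bound on combinations of the [jX (x i)],
    while [q (x i)] is the norm of [T (jX (x i))]. *)
Lemma nuclear_space_summing (E : tvsType K) (q : E -> K) :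
  nuclear_space E -> continuous_seminorm q ->
  exists r : E -> K, continuous_seminorm r /\ exists2 C : K, 0 <= C &
    forall (m : nat) (x : 'I_m -> E) (B : K),
      (forall c : 'I_m -> K, (forall i, `|c i| <= 1) ->
         r (\sum_i c i *: x i) <= B) ->
      \sum_i q (x i) <= C * B.
Proof.
move=> nE /nE[r [cr _ [X [Y [jX [jY [T [[jXr _] [jYq _] TjX nT]]]]]]]].
exists r; split=> //; have [C C0 hC] := nuclear_map_summing nT.
exists C => // m x B hB.
under eq_bigr do rewrite -jYq -TjX.
apply: hC => c /hB; rewrite -jXr linear_sum.
by under eq_bigr do rewrite linearZ.
Qed.

End NuclearSumming.

(** * Sums and integrals of the Cauchy kernel 1 / (1 + t^2) *)

Section CauchyKernel.
Context (R : realType).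
Implicit Types (s t a N : R).

Definition cauchyk t : R := (1 + t ^+ 2)^-1.

Lemma cauchyk_ge0 t : 0 <= cauchyk t.
Proof. by rewrite invr_ge0 addr_ge0// sqr_ge0. Qed.

(** The mean value theorem writes the increment as 1 / (1 + c^2) with t < c < t + 1. Then c^2 is at
    most t^2 or (t + 1)^2 = 2 t^2 + 2 - (t - 1)^2, hence 1 + c^2 <= 3 (1 + t^2). *)
Lemma cauchyk_le_datan t : cauchyk t <= 3 * (atan (t + 1) - atan t).
Proof.
have t1 : t < t + 1 by rewrite ltrDl.
have datan z : z \in `]t, (t + 1)[ -> is_derive z 1 (@atan R) (1 + z ^+ 2)^-1.
  by move=> _; exact: is_derive1_atan.
have catan : {within `[t, t + 1], continuous (@atan R)}.
  by apply: derivable_within_continuous => z _; exact: ex_derive.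
have [c + ->] := MVT t1 datan catan.
rewrite in_itv/= => /andP[tc ct]; rewrite (addrC t) addrK mulr1 /cauchyk.
have h1 : 0 < 1 + t ^+ 2 by rewrite ltr_pwDl// sqr_ge0.
have h2 : 0 < 1 + c ^+ 2 by rewrite ltr_pwDl// sqr_ge0.
rewrite ler_pdivlMr// ler_pdivrMl// mulrC.
by have := sqr_ge0 (t - 1); nra.
Qed.

(** The arctangent increments over unit steps telescope, and the total variation of [atan] is [pi];
    the bound is uniform in [n] and [s]. *)
Lemma sum_cauchyk_le n s : \sum_(i < n) cauchyk (s - i%:R) <= 3 * pi.
Proof.
apply: (@le_trans _ _ (\sum_(i < n) 3 * (atan (i.+1%:R - s) - atan (i%:R - s)))).
  apply: ler_sum => i _.
  have -> : cauchyk (s - i%:R) = cauchyk (i%:R - s).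
    by rewrite /cauchyk -sqrrN opprB.
  by rewrite -[i.+1%:R]natr1 addrAC cauchyk_le_datan.
rewrite -mulr_sumr ler_wpM2l//.
rewrite -(big_mkord xpredT (fun i => atan (i.+1%:R - s) - atan (i%:R - s))).
rewrite (telescope_sumr (fun i => atan (i%:R - s)))//.
have := atan_ltpi2 (n%:R - s); have := atan_gtNpi2 (0%:R - s).
by lra.
Qed.

Lemma continuous_cauchyk_affine N a :
  continuous (fun x : R => cauchyk (N * (x - a))).
Proof.
move=> x; apply: (@continuous_comp _ _ _ (fun x : R => N * (x - a)) cauchyk).
  by apply: cvgM; [exact: cvg_cst|apply: cvgB; [exact: cvg_id|exact: cvg_cst]].
have h : 1 + (N * (x - a)) ^+ 2 != 0 by rewrite gt_eqF// ltr_pwDl// sqr_ge0.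
apply: cvgV => //; apply: cvgD; first exact: cvg_cst.
exact: exprn_continuous.
Qed.

(** The antiderivative [atan (N * (x - a)) / N] varies by less than pi / N, whatever the centre
    [a]. *)
Lemma integral_cauchyk_le N a : 0 < N ->
  (\int[lebesgue_measure]_(x in `[(-1)%R, 1%R]) (cauchyk (N * (x - a)))%:E
    <= (pi / N)%:E)%E.
Proof.
move=> N0.
pose F (x : R) := atan (N * (x - a)) / N.
have dF (x : R) : is_derive x 1 F (cauchyk (N * (x - a))).
  have -> : F = N^-1 *: (fun x => atan (N * (x - a))).
    by apply/funext => y; rewrite /F mulrC.
  have d1 : is_derive x 1 (fun x : R => N * (x - a)) N.
    have -> : (fun x : R => N * (x - a)) = N *: shift (- a).
      by apply/funext => y.
    by apply: is_derive_eq; rewrite subr0 -[LHS]/(N * 1) mulr1.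
  apply: is_derive_eq; rewrite /cauchyk.
  by rewrite -[LHS]/(N^-1 * (_ * N)) mulrCA mulVf ?gt_eqF// mulr1.
rewrite (@continuous_FTC2 _ _ F)//.
- rewrite -EFinB lee_fin /F -mulrBl ler_pM2r ?invr_gt0//.
  have := atan_ltpi2 (N * (1 - a)); have := atan_gtNpi2 (N * (-1 - a)).
  by lra.
- apply: continuous_subspaceT; exact: continuous_cauchyk_affine.
- have cF : continuous F.
    move=> x; apply/differentiable_continuous/derivable1_diffP.
    exact: (@ex_derive _ _ _ _ _ _ _ (dF x)).
  split.
  + by move=> x _; exact: (@ex_derive _ _ _ _ _ _ _ (dF x)).
  + exact/cvg_at_right_filter/cF.
  + exact/cvg_at_left_filter/cF.
- by move=> x _; rewrite derive1E derive_val.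
Qed.

Local Notation leb := (@lebesgue_measure R).

Lemma integral_cauchyk2_le N a (b : R) : 0 < N ->
  (\int[leb \x leb]_(w in `[(-1)%R, 1%R] `*` `[(-1)%R, 1%R])
     (cauchyk (N * (w.1 - a)) * cauchyk (N * (w.2 - b)))%:E
   <= ((pi / N) ^+ 2)%:E)%E.
Proof.
move=> N0; set I := `[(-1)%R, 1%R]%classic.
have mI : measurable I by exact: measurable_itv.
(* Cutting each factor off by the indicator of [I] turns the integral over the square into one over
   the plane, where Tonelli splits it into a product. *)
pose u c (x : R) := cauchyk (N * (x - c)) * \1_I x.
have u0 c x : 0 <= u c x by rewrite mulr_ge0 ?cauchyk_ge0// indicE.
have mu c : measurable_fun [set: measurableTypeR R] (u c).
  apply: measurable_funM; last exact: measurable_indic.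
  apply: continuous_measurable_fun; exact: continuous_cauchyk_affine.
have iu c : (\int[leb]_x (u c x)%:E <= (pi / N)%:E)%E.
  apply: le_trans (integral_cauchyk_le c N0).
  rewrite [leRHS]integral_mkcond le_eqVlt; apply/orP; left; apply/eqP.
  by apply: eq_integral => x _; rewrite patchE /u indicE;
    case: ifPn => xI; rewrite ?mulr1 ?mulr0.
have u2 : measurable_fun [set: measurableTypeR R * measurableTypeR R]
    (fun w => (u a w.1 * u b w.2)%:E).
  apply/measurable_EFinP; apply: measurable_funM.
    by apply: measurableT_comp => //; exact: measurable_fst.
  by apply: measurableT_comp => //; exact: measurable_snd.
rewrite integral_mkcond.
rewrite [leLHS](_ : _ = \int[leb \x leb]_w (u a w.1 * u b w.2)%:E)%E; last first.
  apply: eq_integral => -[x y] _; rewrite patchE /u !indicE/= in_setX/=.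
  by case: (x \in I); case: (y \in I); rewrite /= ?mulr1 ?mulr0 ?mul0r.
rewrite fubini_tonelli1//=; last by move=> w; rewrite lee_fin mulr_ge0.
rewrite /fubini_F/=.
have inner x : (\int[leb]_y (u a x * u b y)%:E =
    (u a x)%:E * \int[leb]_y (u b y)%:E)%E.
  under eq_integral do rewrite EFinM.
  rewrite ge0_integralZl//.
    by apply/measurable_EFinP; exact: mu.
  by move=> y _; rewrite lee_fin.
  by rewrite lee_fin.
under eq_integral do rewrite inner.
rewrite ge0_integralZr//; last first.
- by apply: integral_ge0 => y _; rewrite lee_fin.
- by move=> y _; rewrite lee_fin.
- by apply/measurable_EFinP; exact: mu.
by rewrite expr2 EFinM lee_pmul//; apply: integral_ge0 => y _; rewrite lee_fin.
Qed.

End CauchyKernel.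

Local Open Scope complex_scope.

(** * The atoms: pointwise bounds and analyticity *)

Section Atoms.
Context (R : realType).
Implicit Types (N k i : nat) (x y mu : R) (z : R[i]).

Lemma normc_ge0 z : 0 <= normc z.
Proof. by case: z => a b; exact: sqrtr_ge0. Qed.

Lemma normc_sqrE x y : normc (x +i* y) ^+ 2 = x ^+ 2 + y ^+ 2.
Proof. by rewrite sqr_sqrtr// addr_ge0// sqr_ge0. Qed.

(* [node N i] is the point of the unit circle with ordinate [i / N]. *)
Definition node_im N i : R := i%:R / N%:R.
Definition node_re N i : R := Num.sqrt (1 - node_im N i ^+ 2).

Lemma node_sqr N i : (i < N)%N -> node_re N i ^+ 2 + node_im N i ^+ 2 = 1.
Proof.
move=> iN; rewrite sqr_sqrtr ?subrK// subr_ge0 expr_le1//.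
  by rewrite ler_pdivrMr ?ltr0n ?(leq_trans _ iN)// mul1r ler_nat ltnW.
by rewrite divr_ge0.
Qed.

Definition atom_base N i z : R[i] :=
  1 + N%:R * (1 - (node_re N i -i* node_im N i) * z).

(* For a weight mu <= k, k of the k + 2 factors absorb (1 - |z|)^mu and the other
   two dominate a product of Cauchy kernels in the two coordinates. *)
Definition atom N k i z : R[i] :=
  if `|z| < 1 then (atom_base N i z ^+ (2 * (k + 2)))^-1 else 0.

(** With z = x + iy and zeta the node, this is 1 + N^2 |z - zeta|^2. *)
Definition atom_majorant N i x y : R :=
  1 + (N%:R * (x - node_re N i)) ^+ 2 + (N%:R * (y - node_im N i)) ^+ 2.

Lemma atom_majorant_ge1 N i x y : 1 <= atom_majorant N i x y.
Proof. by rewrite /atom_majorant -addrA lerDl addr_ge0// sqr_ge0. Qed.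

(** Cauchy-Schwarz against a unit vector (a, b); the defect of the squares is (a y - b x)^2. *)
Lemma dotr_le_normc N i x y : (i < N)%N ->
  node_re N i * x + node_im N i * y <= normc (x +i* y).
Proof.
move=> iN; have ab := node_sqr iN.
have [|d0] := leP (node_re N i * x + node_im N i * y) 0.
  by move=> /le_trans; apply; exact: normc_ge0.
rewrite -[leRHS]ger0_norm ?normc_ge0// -[leLHS]ger0_norm ?(ltW d0)//.
rewrite -ler_sqr ?nnegrE ?normr_ge0// !real_normK ?num_real// normc_sqrE.
rewrite -[leRHS]mul1r -ab.
by have := sqr_ge0 (node_re N i * y - node_im N i * x); nra.
Qed.

Lemma atom_baseE N i x y : atom_base N i (x +i* y) =
  (1 + N%:R * (1 - (node_re N i * x + node_im N i * y))) +i*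
  (- (N%:R * (node_re N i * y - node_im N i * x))).
Proof.
rewrite /atom_base -[N%:R : R[i]](rmorph_nat (@real_complex R)).
by simpc; congr (_ +i* _); ring.
Qed.

(** Put w = N (1 - conj zeta z). Then |1 + w|^2 = 1 + 2 Re w + |w|^2 with Re w >= 0 on the closed
    disc, and |1 - conj zeta z| = |z - zeta| because |zeta| = 1. *)
Lemma atom_majorant_le N i x y : (i < N)%N -> normc (x +i* y) <= 1 ->
  atom_majorant N i x y <= normc (atom_base N i (x +i* y)) ^+ 2.
Proof.
move=> iN xy1; rewrite atom_baseE normc_sqrE /atom_majorant.
have ab := node_sqr iN; have dn := le_trans (dotr_le_normc x y iN) xy1.
have N0 : 0 <= N%:R :> R by [].
set a := node_re N i in ab dn *; set b := node_im N i in ab dn *.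
set n := N%:R in N0 *.
have -> : (1 + n * (1 - (a * x + b * y))) ^+ 2 + (- (n * (a * y - b * x))) ^+ 2
  = 1 + n * 2 * (1 - (a * x + b * y)) +
    n ^+ 2 * (1 - 2 * (a * x + b * y) + (a ^+ 2 + b ^+ 2) * (x ^+ 2 + y ^+ 2)).
  by ring.
have -> : 1 + (n * (x - a)) ^+ 2 + (n * (y - b)) ^+ 2 =
    1 + n ^+ 2 * (a ^+ 2 + b ^+ 2 - 2 * (a * x + b * y) + (x ^+ 2 + y ^+ 2)).
  by ring.
by rewrite ab mul1r lerD2r lerDl !mulr_ge0// subr_ge0.
Qed.

Lemma unit_normc z : (`|z| < 1) = (normc z < 1).
Proof. exact: (ltcR (normc z) 1). Qed.

Lemma normc_atom N k i z : normc z < 1 ->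
  normc (atom N k i z) = ((normc (atom_base N i z) ^+ 2) ^+ (k + 2))^-1.
Proof.
move=> z1; rewrite /atom unit_normc z1; apply: complexI.
by rewrite -Defs.normcE normfV normrX Defs.normcE -!rmorphXn/= fmorphV exprM.
Qed.

Lemma normc_atom_le N k i x y : (i < N)%N ->
  normc (atom N k i (x +i* y)) <= (atom_majorant N i x y ^+ (k + 2))^-1.
Proof.
move=> iN; have h1 := atom_majorant_ge1 N i x y.
have h0 : 0 < atom_majorant N i x y by exact: lt_le_trans ltr01 h1.
have [z1|z1] := ltP (normc (x +i* y)) 1; last first.
  have -> : atom N k i (x +i* y) = 0 by rewrite /atom unit_normc ltNge z1.
  by rewrite normc0 invr_ge0 exprn_ge0// ltW.
rewrite normc_atom//; have hb := atom_majorant_le iN (ltW z1).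
have hb0 := lt_le_trans h0 hb.
rewrite lef_pV2 ?posrE; [|exact: exprn_gt0..].
by rewrite lerXn2r ?nnegrE ?(ltW h0) ?(ltW hb0).
Qed.

(** Only the vertical distance to the nodes is kept: their ordinates are i / N, so the majorant is
    at least 1 + (N y - i)^2 and the sum is one of Cauchy kernels at unit spacing. *)
Lemma sum_normc_atom_le N k x y :
  \sum_(i < N) normc (atom N k i (x +i* y)) <= 3 * pi.
Proof.
case: N => [|N]; first by rewrite big_ord0 mulr_ge0// pi_ge0.
apply: le_trans (sum_cauchyk_le N.+1 (N.+1%:R * y)).
apply: ler_sum => i _; apply: le_trans (normc_atom_le _ _ _ (ltn_ord i)) _.
have h1 := atom_majorant_ge1 N.+1 i x y.
have h0 : 0 < atom_majorant N.+1 i x y by exact: lt_le_trans ltr01 h1.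
rewrite /cauchyk lef_pV2 ?posrE ?exprn_gt0// ?ltr_pwDl ?sqr_ge0//.
apply: (@le_trans _ _ (atom_majorant N.+1 i x y)).
  have -> : N.+1%:R * y - i%:R = N.+1%:R * (y - node_im N.+1 i) :> R.
    by rewrite mulrBr /node_im mulrCA divff// mulr1.
  by rewrite /atom_majorant addrAC lerDl sqr_ge0.
by rewrite -[leLHS]expr1 ler_weXn2l// addn2.
Qed.

Lemma atom_weight_le N k i x y mu : (i < N)%N -> 0 <= mu <= k%:R ->
  normc (x +i* y) < 1 ->
  normc (atom N k i (x +i* y)) * (1 - normc (x +i* y)) `^ mu <=
  N%:R `^ (- mu) * (cauchyk (N%:R * (x - node_re N i)) *
                    cauchyk (N%:R * (y - node_im N i))).
Proof.
move=> iN /andP[mu0 muk] z1; have N0 : 0 < N%:R :> R.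
  by rewrite ltr0n (leq_trans _ iN).
set r := normc (x +i* y) in z1 *; set h := atom_majorant N i x y.
have h1 : 1 <= h := atom_majorant_ge1 N i x y.
have h0 : 0 < h by exact: lt_le_trans ltr01 h1.
have r1 : 0 <= 1 - r by rewrite subr_ge0 ltW.
(* Since 1 - |z| <= |z - zeta|, the square of t = N (1 - |z|) is at most h - 1; then 2 t <= t^2 + 1
   <= h. *)
have th : N%:R * (1 - r) <= h.
  have : (N%:R * (1 - r)) ^+ 2 <= h - 1.
    have ab := node_sqr iN; have dn := dotr_le_normc x y iN.
    have rr := normc_sqrE x y; rewrite -/r in dn rr.
    have -> : h - 1 = (N%:R * (x - node_re N i)) ^+ 2 +
        (N%:R * (y - node_im N i)) ^+ 2 by rewrite /h /atom_majorant; ring.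
    rewrite !exprMn -mulrDr ler_wpM2l ?sqr_ge0//.
    by move: ab dn rr; set a := node_re _ _; set b := node_im _ _; nra.
  by have := sqr_ge0 (N%:R * (1 - r) - 1); nra.
have -> : (1 - r) `^ mu = N%:R `^ (- mu) * (N%:R * (1 - r)) `^ mu.
  rewrite powRM// mulrA powRN mulVf ?mul1r// gt_eqF// powR_gt0//.
rewrite mulrCA ler_wpM2l ?powR_ge0//.
have tk : (N%:R * (1 - r)) `^ mu <= h ^+ k.
  apply: (@le_trans _ _ (h `^ mu)).
    by apply: ge0_ler_powR; rewrite ?nnegrE ?(ltW h0)// mulr_ge0.
  by rewrite -(powR_mulrn _ (ltW h0)) ler_powR.
apply: (@le_trans _ _ ((h ^+ (k + 2))^-1 * h ^+ k)).
  by apply: ler_pM; rewrite ?normc_ge0 ?powR_ge0// normc_atom_le.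
have hk0 : h ^+ k != 0 by rewrite expf_neq0// gt_eqF.
have -> : (h ^+ (k + 2))^-1 * h ^+ k = h^-1 * h^-1.
  by rewrite exprD invfM mulrAC mulVf// mul1r expr2 invfM.
have hinv t : 1 + t ^+ 2 <= h -> h^-1 <= cauchyk t.
  by move=> ht; rewrite /cauchyk lef_pV2// posrE ltr_pwDl// sqr_ge0.
have hV0 : 0 <= h^-1 by rewrite invr_ge0 ltW.
apply: ler_pM => //; apply: hinv; rewrite /h /atom_majorant.
  by rewrite lerDl sqr_ge0.
by rewrite addrAC lerDl sqr_ge0.
Qed.

Lemma analytic_atom N k i : (i < N)%N -> analytic_disc (atom N k i).
Proof.
move=> iN; split => z; last by move=> /negP/negbTE z1; rewrite /atom z1.
move=> z1.
(* A zero of the base would contradict that its squared modulus dominates the majorant, which is at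
   least 1. *)
have b0 : atom_base N i z != 0.
  apply/eqP => b0; case: z z1 b0 => x y z1 b0.
  have := atom_majorant_le iN (ltW (_ : normc (x +i* y) < 1)).
  rewrite -unit_normc => /(_ z1); rewrite b0 normc0 expr0n/=.
  by apply/negP; rewrite -ltNge (lt_le_trans ltr01)// atom_majorant_ge1.
(* The cutoff in [atom] is invisible on the ball of radius 1 - |z| around z, so derivability is that
   of a rational function. *)
apply: (@near_eq_derivable _ R[i]^o R[i]^o
  (fun z => (atom_base N i z ^+ (2 * (k + 2)))^-1)).
  have : 0 < 1 - `|z| by rewrite subr_gt0.
  move=> /(nbhsx_ballx (z : R[i]^o)); apply: filterS => u.
  rewrite -ball_normE/= => zu; rewrite /atom ifT//.
  rewrite -[u](subrK z) (le_lt_trans (ler_normD _ _))//.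
  by rewrite -ltrBrDr distrC.
apply: (@derivableV _ R[i]^o (fun z => atom_base N i z ^+ (2 * (k + 2)))).
  by rewrite expf_neq0.
pose b : R[i]^o -> R[i]^o := atom_base N i.
have -> : (fun z => atom_base N i z ^+ (2 * (k + 2))) = b ^+ (2 * (k + 2)).
  by rewrite exprfctE.
apply: derivableX.
have -> : b = cst 1 + (N%:R : R[i]) *: (cst 1 - (node_re N i -i* node_im N i) *: id).
  by [].
apply: derivableD; first exact: derivable_cst.
apply: derivableZ; apply: derivableB; first exact: derivable_cst.
by apply: derivableZ; exact: derivable_id.
Qed.

End Atoms.

(** * Integral bounds, from above for combinations of atoms and from below for one atom *)

Section AtomNorms.
Context (R : realType).
Implicit Types (N k : nat) (x y mu p : R) (z : R[i]).

Local Notation leb2 := (@lebesgue_measure R \x @lebesgue_measure R)%E.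

Lemma analytic_disc_sum N (c : 'I_N -> R[i]) (f : 'I_N -> R[i] -> R[i]) :
  (forall i, analytic_disc (f i)) -> analytic_disc (\sum_i c i *: f i).
Proof.
move=> af; elim/big_ind: _ => [|g h ag ah|i _].
- exact: analytic_disc0.
- exact: analytic_discD.
- exact: analytic_discZ.
Qed.

(** Since x / M lies in [0, 1] and p >= 1, (x / M)^p <= x / M. This replaces the p-th power of a
    bounded sum by the sum itself, which can be integrated term by term. *)
Lemma powR_le_linear p x M : 1 <= p -> 0 <= x -> x <= M -> 0 < M ->
  x `^ p <= M `^ p / M * x.
Proof.
move=> p1 x0 xM M0; have [->|xn0] := eqVneq x 0.
  by rewrite powR0 ?mulr0// gt_eqF// (lt_le_trans ltr01).
have xM0 : 0 < x / M by rewrite divr_gt0// lt_neqAle eq_sym xn0.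
rewrite -{1}(divfK (lt0r_neq0 M0) x) powRM ?(ltW M0) ?(ltW xM0)// mulrC.
rewrite -mulrA [M^-1 * x]mulrC ler_wpM2l ?powR_ge0//.
rewrite -[leRHS]powRr1 ?(ltW xM0)// ger_powR// xM0/=.
by rewrite ler_pdivrMr// mul1r.
Qed.

Lemma measurable_bergman_integrand p mu f : analytic_disc f ->
  measurable_fun (@unit_disc R : set (measurableTypeR R * measurableTypeR R))
   (fun w => (normc (f (w.1 +i* w.2)) `^ p *
      (1 - normc (w.1 +i* w.2)) `^ mu)%:E).
Proof.
move=> af; apply: measurable_funTS; apply/measurable_EFinP.
apply: measurable_funM; last exact: measurable_weight.
apply: (@measurableT_comp _ _ _ _ _ _ (@powR R ^~ p)) => //.
exact: measurable_modulus.
Qed.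

Lemma unit_disc_sub_square :
  @unit_disc R `<=` `[(-1)%R, 1%R] `*` `[(-1)%R, 1%R].
Proof.
move=> [x y] /= w1; have n0 := normc_ge0 (x +i* y).
have := normc_sqrE x y; have := sqr_ge0 x; have := sqr_ge0 y => y0 x0 nE.
have n1 : normc (x +i* y) ^+ 2 <= 1 by rewrite expr_le1// ltW.
by split; rewrite /= in_itv/=; apply/andP; split; nra.
Qed.

(** The sum of the moduli of the atoms is at most M = 3 pi, so |f|^p is at most M^p / M times that
    sum. Each weighted atom contributes at most N^(-mu) (pi / N)^2 to the integral, and the N
    contributions add up to the order N^(-(1 + mu)). *)
Lemma bergman_int_sum_atom_le p mu k N (c : 'I_N -> R[i]) :
  1 <= p -> 0 <= mu <= k%:R -> (0 < N)%N -> (forall i, `|c i| <= 1) ->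
  (bergman_int p mu (\sum_i c i *: @atom R N k i)%R <=
   (pi * ((3 * pi) `^ p / (3 * pi)) * N%:R `^ (- (1 + mu)))%:E)%E.
Proof.
move=> p1 muk N0 c1; set f := \sum_i _.
have af : analytic_disc f.
  by apply: analytic_disc_sum => i; exact: analytic_atom.
have n0 : 0 < N%:R :> R by rewrite ltr0n.
have pi0 := pi_gt0 R.
set D := (3 * pi) `^ p / (3 * pi).
have M0 : 0 < 3 * pi :> R by rewrite mulr_gt0.
have D0 : 0 <= D by rewrite divr_ge0 ?powR_ge0 ?ltW.
pose g (i : 'I_N) (w : R * R) := cauchyk (N%:R * (w.1 - node_re R N i)) *
                      cauchyk (N%:R * (w.2 - node_im R N i)).
have g0 i w : 0 <= g i w by rewrite mulr_ge0 ?cauchyk_ge0.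
have mg i : measurable_fun [set: measurableTypeR R * measurableTypeR R]
    (fun w => (g i w)%:E).
  have mck a : measurable_fun [set: measurableTypeR R]
      (fun x => cauchyk (N%:R * (x - a))).
    apply: continuous_measurable_fun; exact: continuous_cauchyk_affine.
  apply/measurable_EFinP; apply: measurable_funM.
    apply: (measurableT_comp (mck _)); exact: measurable_fst.
  apply: (measurableT_comp (mck _)); exact: measurable_snd.
have E0 : 0 <= D * N%:R `^ (- mu) by rewrite mulr_ge0 ?powR_ge0.
have pw w : unit_disc w ->
    normc (f (w.1 +i* w.2)) `^ p * (1 - normc (w.1 +i* w.2)) `^ mu <=
    D * N%:R `^ (- mu) * \sum_i g i w.
  case: w => x y w1 /=.
  have fS : normc (f (x +i* y)) <= \sum_(i < N) normc (@atom R N k i (x +i* y)).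
    rewrite /f fct_sumE; elim/big_ind2: _ => [|a b a' b' ab ab'|i _].
    - by rewrite normc0.
    - by rewrite (le_trans (le_normcD _ _))// lerD.
    - rewrite -[(_ *: _) _]/(c i * @atom R N k i (x +i* y)) normcM.
      by rewrite ler_piMl ?normc_ge0// -(lecR _ 1); exact: c1.
  have SM := sum_normc_atom_le N k x y.
  have n_ge0 := normc_ge0 (f (x +i* y)).
  apply: (@le_trans _ _ ((D * \sum_(i < N) normc (@atom R N k i (x +i* y))) *
      (1 - normc (x +i* y)) `^ mu)).
    rewrite ler_wpM2r ?powR_ge0//.
    apply: le_trans (powR_le_linear p1 n_ge0 (le_trans fS SM) M0) _.
    by rewrite ler_wpM2l.
  rewrite -[leLHS]mulrA -[leRHS]mulrA ler_wpM2l// mulr_suml mulr_sumr ler_sum// => i _.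
  exact: atom_weight_le.
have ig : (\int[leb2]_(w in @unit_disc R) (\sum_(i < N) g i w)%R%:E <=
    (N%:R * (pi / N%:R) ^+ 2)%:E)%E.
  under eq_integral do rewrite -sumEFin.
  rewrite ge0_integral_sum//; last 3 first.
  - exact: measurable_unit_disc.
  - by move=> i; exact: measurable_funTS.
  - by move=> i w _; rewrite lee_fin.
  have -> : N%:R * (pi / N%:R) ^+ 2 = \sum_(i < N) (pi / N%:R) ^+ 2 :> R.
    by rewrite sumr_const card_ord -[RHS]mulr_natl.
  rewrite -sumEFin; apply: lee_sum => i _.
  apply: le_trans (integral_cauchyk2_le (node_re R N i) (node_im R N i) n0).
  apply: ge0_subset_integral.
  - exact: measurable_unit_disc.
  - by apply: measurableX; exact: measurable_itv.
  - by move=> /=; apply: measurable_funTS; exact: mg.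
  - by move=> w _; rewrite lee_fin; exact: g0.
  - exact: unit_disc_sub_square.
rewrite /bergman_int.
apply: (@le_trans _ _ ((pi^-1)%:E *
  ((D * N%:R `^ (- mu))%:E * (N%:R * (pi / N%:R) ^+ 2)%:E))%E).
  rewrite lee_wpmul2l ?lee_fin ?invr_ge0 ?(ltW pi0)//.
  apply: (@le_trans _ _ ((D * N%:R `^ (- mu))%:E *
      \int[leb2]_(w in @unit_disc R) (\sum_(i < N) g i w)%R%:E)%E); last first.
    by rewrite lee_wpmul2l// lee_fin.
  have mS : measurable_fun (@unit_disc R : set (measurableTypeR R * measurableTypeR R))
     (fun w => (\sum_(i < N) g i w)%R%:E).
    apply: measurable_funTS.
    under eq_fun do rewrite -sumEFin.
    by apply: emeasurable_sum => i; exact: mg.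
  rewrite -ge0_integralZl//; last 2 first.
  - exact: measurable_unit_disc.
  - by move=> w _; rewrite lee_fin sumr_ge0.
  apply: ge0_le_integral => //.
  - exact: measurable_unit_disc.
  - by move=> w _; rewrite lee_fin mulr_ge0 ?powR_ge0.
  - exact: measurable_bergman_integrand.
  - exact: measurable_funeM.
rewrite -!EFinM lee_fin le_eqVlt; apply/orP; left; apply/eqP.
rewrite opprD powRD; last by apply/implyP; rewrite (gt_eqF n0).
rewrite powR_inv1 ?(ltW n0)//.
have alg (a d m n : R) : a != 0 -> n != 0 ->
    a^-1 * (d * m * (n * (a / n) ^+ 2)) = a * d * (n^-1 * m).
  by move=> a0 m0; field; rewrite ?a0 ?m0.
by apply: alg; exact: lt0r_neq0.
Qed.

(** With s = N (x - a) and t = N (y - b), the squared modulus of the base is 1 - 2 (a s + b t) + s^2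
    + t^2. For |s|, |t| <= 5/2 this is at most 1 + 10 + 25/2 < 25. *)
Lemma normc_atom_ge N k i x y : (i < N)%N -> normc (x +i* y) < 1 ->
  `|x - node_re R N i| <= 5 / 2 / N%:R -> `|y - node_im R N i| <= 5 / 2 / N%:R ->
  25^-1 ^+ (k + 2) <= normc (@atom R N k i (x +i* y)).
Proof.
move=> iN z1 xa yb; rewrite normc_atom// -exprVn.
have h := lt_le_trans ltr01 (le_trans (atom_majorant_ge1 N i x y)
  (atom_majorant_le iN (ltW z1))).
rewrite lerXn2r ?nnegrE ?invr_ge0 ?(ltW h)// lef_pV2 ?posrE//.
have n0 : 0 < N%:R :> R by rewrite ltr0n (leq_trans _ iN).
have ab := node_sqr R iN.
rewrite atom_baseE normc_sqrE.
set a := node_re R N i in xa ab *; set b := node_im R N i in yb ab *.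
pose s := (x - a) * N%:R; pose t := (y - b) * N%:R.
have s5 : `|s| <= 5 / 2 by rewrite normrM (gtr0_norm n0) -ler_pdivlMr.
have t5 : `|t| <= 5 / 2 by rewrite normrM (gtr0_norm n0) -ler_pdivlMr.
have a1 : `|a| <= 1 by rewrite ler_norml; nra.
have b1 : `|b| <= 1 by rewrite ler_norml; nra.
have -> : (1 + N%:R * (1 - (a * x + b * y))) ^+ 2 +
    (- (N%:R * (a * y - b * x))) ^+ 2 =
    1 - 2 * (a * s + b * t) + (s ^+ 2 + t ^+ 2).
  transitivity ((1 + N%:R * (a ^+ 2 + b ^+ 2 - (a * x + b * y))) ^+ 2 +
    (- (N%:R * (a * y - b * x))) ^+ 2); first by rewrite ab.
  transitivity (1 - 2 * (a * s + b * t) + (a ^+ 2 + b ^+ 2) * (s ^+ 2 + t ^+ 2)).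
    by rewrite /s /t; ring.
  by rewrite ab mul1r.
have as5 : - (5 / 2) <= a * s.
  rewrite lerNl (le_trans (ler_norm _))// normrN normrM.
  by rewrite (le_trans (ler_pM _ _ a1 s5))// mul1r.
have bt5 : - (5 / 2) <= b * t.
  rewrite lerNl (le_trans (ler_norm _))// normrN normrM.
  by rewrite (le_trans (ler_pM _ _ b1 t5))// mul1r.
have sq (u : R) : `|u| <= 5 / 2 -> u ^+ 2 <= 25 / 4.
  by move=> u5; rewrite -real_normK ?num_real//; have := normr_ge0 u; nra.
by have := sq _ s5; have := sq _ t5; lra.
Qed.

(** The integral is restricted to a square of area N^(-2) inside the disc, on which the atom is
    bounded below and 1 - |z| >= 1/N. *)
Lemma bergman_int_atom_ge p mu k N i : 0 <= p -> 0 <= mu ->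
  (1 < N)%N -> (i < N)%N ->
  ((pi^-1 * ((25^-1 ^+ (k + 2)) `^ p * N%:R `^ (- (2 + mu))))%:E <=
   bergman_int p mu (@atom R N k i))%E.
Proof.
move=> p0 mu0 N1 iN; have pi0 := pi_gt0 R.
have n0 : 0 < N%:R :> R by rewrite ltr0n ltnW.
have n2 : 2 <= N%:R :> R by rewrite (ler_nat _ 2).
set a := node_re R N i; set b := node_im R N i.
have ab : a ^+ 2 + b ^+ 2 = 1 := node_sqr R iN.
have a1 : `|a| <= 1 by rewrite ler_norml; nra.
have b1 : `|b| <= 1 by rewrite ler_norml; nra.
pose q : R := N%:R^-1.
have q0 : 0 < q by rewrite invr_gt0.
(* This uses N >= 2 and makes the scaling factor 1 - 2 q of the centre nonnegative. *)
have q2 : q <= 2^-1 by rewrite lef_pV2// posrE.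
(* [I a `*` I b] is the square of side 1/N centred at (1 - 2/N)(a + ib). *)
pose I (c : R) := `[(1 - 2 * q) * c - q / 2, (1 - 2 * q) * c + q / 2]%classic.
have IE c x : I c x -> `|x - (1 - 2 * q) * c| <= q / 2.
  by rewrite /I/= in_itv/= => /andP[h1 h2]; rewrite ler_norml; apply/andP; split; lra.
(* The constant 5/2 is 1/2 for the half side plus 2 for the displacement of the centre, in units of
   1/N. *)
have IE' c x : `|c| <= 1 -> I c x -> `|x - c| <= 5 / 2 / N%:R.
  move=> c1 /IE h; rewrite -/q.
  rewrite (_ : x - c = (x - (1 - 2 * q) * c) - 2 * q * c); last by ring.
  rewrite (le_trans (ler_normB _ _))// !normrM (ger0_norm (ltW q0)) ger0_norm//.
  by have := ler_wpM2l (ltW q0) c1; lra.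
(* The centre has modulus 1 - 2 q, and the two half sides add at most q. *)
have disc x y : I a x -> I b y -> normc (x +i* y) <= 1 - q.
  move=> /IE xa /IE yb.
  have -> : x +i* y = ((x - (1 - 2 * q) * a) +i* (y - (1 - 2 * q) * b)) +
     (((1 - 2 * q) * a) +i* ((1 - 2 * q) * b)).
    by simpc; rewrite !subrK.
  apply: le_trans (le_normcD _ _) _.
  have -> : normc (((1 - 2 * q) * a) +i* ((1 - 2 * q) * b)) = 1 - 2 * q.
    rewrite /normc [(_ * a) ^+ 2]exprMn [(_ * b) ^+ 2]exprMn -mulrDr ab mulr1 sqrtr_sqr ger0_norm//; lra.
  have := normc_le (x - (1 - 2 * q) * a) (y - (1 - 2 * q) * b); lra.
have mI c : measurable (I c : set (measurableTypeR R)) by exact: measurable_itv.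
have sub : I a `*` I b `<=` @unit_disc R.
  by move=> [x y] [/= xa yb]; have := disc _ _ xa yb; rewrite /unit_disc/=; lra.
have measI c : lebesgue_measure (I c) = q%:E.
  rewrite lebesgue_measure_itv/= lte_fin ifT; last by lra.
  by rewrite -EFinB; congr _%:E; lra.
rewrite /bergman_int EFinM lee_wpmul2l ?lee_fin ?invr_ge0 ?(ltW pi0)//.
set m := 25^-1 ^+ (k + 2).
apply: (@le_trans _ _ (\int[leb2]_(w in I a `*` I b) (m `^ p * q `^ mu)%:E)%E).
  rewrite integral_cst; last exact: measurableX.
  rewrite [X in (_ * X)%E](_ : _ = (q * q)%:E); last first.
    rewrite -[LHS]/((leb2 (I a `*` I b))%E) product_measure1E// EFinM.
    by congr (_ * _)%E; exact: measI.
  rewrite -EFinM lee_fin -mulrA ler_wpM2l ?powR_ge0//.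
  have qP : q = N%:R `^ (- 1) by rewrite powR_inv1// ltW.
  rewrite (_ : - (2 + mu) = - 1 * mu + (- 1 + - 1)); last by lra.
  by rewrite !powRD ?(gt_eqF n0) ?implybT// powRrM -qP.
apply: (@le_trans _ _ (\int[leb2]_(w in I a `*` I b)
    (normc (@atom R N k i (w.1 +i* w.2)) `^ p *
      (1 - normc (w.1 +i* w.2)) `^ mu)%:E)%E).
  apply: ge0_le_integral => //.
  - exact: measurableX.
  - by move=> w _; rewrite lee_fin mulr_ge0 ?powR_ge0.
  - apply: (measurable_funS (@measurable_unit_disc R) sub).
    by apply: measurable_bergman_integrand; exact: analytic_atom.
  - move=> [x y] [/= xa yb]; rewrite lee_fin.
    have nz := disc _ _ xa yb.
    have nz1 : normc (x +i* y) < 1 by move: nz; lra.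
    apply: ler_pM; rewrite ?powR_ge0//.
      apply: ge0_ler_powR; rewrite ?nnegrE ?normc_ge0 ?exprn_ge0//.
      exact: (normc_atom_ge k iN nz1 (IE' _ _ a1 xa) (IE' _ _ b1 yb)).
    by apply: ge0_ler_powR; rewrite ?nnegrE ?(ltW q0) ?subr_ge0 ?(ltW nz1)// lerBrDl -lerBrDr.
apply: ge0_subset_integral => //.
- exact: measurableX.
- exact: measurable_unit_disc.
- by apply: measurable_bergman_integrand; exact: analytic_atom.
- by move=> w _; rewrite lee_fin mulr_ge0 ?powR_ge0.
Qed.

End AtomNorms.

(** * Bergman norms of the atoms, with constants independent of N *)

Section BergmanNorm.
Context (R : realType).
Implicit Types (N k : nat) (mu p : R).

Lemma ler_bergman_norm p mu1 mu2 (f : R[i] -> R[i]) :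
  0 < p -> mu1 <= mu2 -> bergman p mu1 f ->
  bergman_norm p mu2 f <= bergman_norm p mu1 f.
Proof.
move=> p0 mu12 bf; have [af If2] := sub_bergman p0 mu12 bf; have [_ If1] := bf.
have le12 : (bergman_int p mu2 f <= bergman_int p mu1 f)%E; last first.
  have h1 := bergman_int_ge0 p mu1 f; have h2 := bergman_int_ge0 p mu2 f.
  move: le12 If1 If2 h1 h2; rewrite /bergman_norm.
  move: (bergman_int p mu1 f) (bergman_int p mu2 f) => a b ba ai bi a0 b0.
  apply: ge0_ler_powR; rewrite ?invr_ge0 ?(ltW p0) ?nnegrE ?fine_ge0//.
  by rewrite fine_le ?ge0_fin_numE.
rewrite /bergman_int lee_wpmul2l ?lee_fin ?invr_ge0 ?pi_ge0//.
apply: ge0_le_integral.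
- exact: measurable_unit_disc.
- by move=> w _; rewrite lee_fin mulr_ge0 ?powR_ge0.
- exact: measurable_bergman_integrand.
- exact: measurable_bergman_integrand.
move=> w w1; rewrite lee_fin ler_wpM2l ?powR_ge0// ger_powR//.
by rewrite subr_gt0 w1/= gerBl.
Qed.

Lemma bergman_norm_sum_atom_le p mu k : 1 <= p -> 0 <= mu <= k%:R ->
  exists2 C : R, 0 < C & forall N (c : 'I_N -> R[i]), (0 < N)%N ->
    (forall i, `|c i| <= 1) ->
    bergman p mu (\sum_i c i *: @atom R N k i) /\
    bergman_norm p mu (\sum_i c i *: @atom R N k i) <=
      C * N%:R `^ (- ((1 + mu) / p)).
Proof.
move=> p1 muk; have pi0 := pi_gt0 R; have p0 := lt_le_trans ltr01 p1.
set D := pi * ((3 * pi) `^ p / (3 * pi)).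
have M0 : 0 < 3 * pi :> R by rewrite mulr_gt0.
have D0 : 0 < D by rewrite mulr_gt0 ?divr_gt0 ?powR_gt0.
exists (D `^ p^-1) => [|N c N0 c1]; first by rewrite powR_gt0.
set f := \sum_i _.
have fle : (bergman_int p mu f <= _)%E := bergman_int_sum_atom_le p1 muk N0 c1.
have bf : bergman p mu f.
  split; last by apply: le_lt_trans fle _; rewrite ltry.
  by apply: analytic_disc_sum => i; exact: analytic_atom.
split=> //.
apply: (@le_trans _ _ ((D * N%:R `^ (- (1 + mu))) `^ p^-1)).
  have Dn0 : 0 <= D * N%:R `^ (- (1 + mu)) by rewrite mulr_ge0 ?powR_ge0// ltW.
  apply: ge0_ler_powR;
    rewrite ?invr_ge0 ?(ltW p0) ?nnegrE ?fine_ge0 ?bergman_int_ge0//.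
  rewrite -[leRHS]/(fine (D * N%:R `^ (- (1 + mu)))%:E).
  by apply: fine_le; rewrite // ge0_fin_numE ?bergman_int_ge0//; case: bf.
by rewrite powRM ?powR_ge0 ?(ltW D0)// -powRrM mulNr.
Qed.

(** A single atom is the combination whose coefficients form a Kronecker delta. *)
Lemma bergman_atom p mu k N i : 1 <= p -> 0 <= mu <= k%:R -> (i < N)%N ->
  bergman p mu (@atom R N k i).
Proof.
move=> p1 muk iN; have [C _ hC] := bergman_norm_sum_atom_le p1 muk.
pose c (j : 'I_N) : R[i] := (j == Ordinal iN)%:R.
have -> : @atom R N k i = \sum_(j < N) c j *: @atom R N k j.
  rewrite (bigD1 (Ordinal iN)) //= /c eqxx scale1r big1 ?addr0//.
  by move=> j /negbTE ->; rewrite scale0r.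
have [|//] := hC N c (leq_ltn_trans (leq0n _) iN).
by move=> j; rewrite /c; case: eqP => _; rewrite ?normr1 ?normr0.
Qed.

Lemma bergman_norm_atom_ge p mu k : 1 <= p -> 0 <= mu <= k%:R ->
  exists2 C : R, 0 < C & forall N i, (1 < N)%N -> (i < N)%N ->
    C * N%:R `^ (- ((2 + mu) / p)) <= bergman_norm p mu (@atom R N k i).
Proof.
move=> p1 muk; have pi0 := pi_gt0 R; have p0 := lt_le_trans ltr01 p1.
set D := pi^-1 * (25^-1 ^+ (k + 2)) `^ p : R.
have D0 : 0 < D by rewrite mulr_gt0 ?invr_gt0 ?powR_gt0 ?exprn_gt0 ?invr_gt0.
exists (D `^ p^-1) => [|N i N1 iN]; first by rewrite powR_gt0.
have [_ If] := bergman_atom p1 muk iN.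
have mu0 : 0 <= mu by case/andP: muk.
have := bergman_int_atom_ge k (ltW p0) mu0 N1 iN; rewrite mulrA -/D => Dle.
apply: (@le_trans _ _ ((D * N%:R `^ (- (2 + mu))) `^ p^-1)).
  by rewrite powRM ?powR_ge0 ?(ltW D0)// -powRrM mulNr.
have Dn0 : 0 <= D * N%:R `^ (- (2 + mu)) by rewrite mulr_ge0 ?powR_ge0// ltW.
apply: ge0_ler_powR;
  rewrite ?invr_ge0 ?(ltW p0) ?nnegrE ?fine_ge0 ?bergman_int_ge0//.
rewrite -[leLHS]/(fine (D * N%:R `^ (- (2 + mu)))%:E).
by apply: fine_le; rewrite // ge0_fin_numE ?bergman_int_ge0.
Qed.

Lemma powR_nat_unbounded (e A : R) : 0 < e ->
  exists2 N, (1 < N)%N & A < N%:R `^ e.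
Proof.
move=> e0; set B := (`|A| + 1) `^ e^-1.
(* The first successor exceeds [B], the e-th root of |A| + 1; the second ensures 1 < N. *)
exists (Num.truncn B).+2 => //.
have A1 : 0 < `|A| + 1 by rewrite ltr_wpDl.
apply: (@lt_le_trans _ _ (`|A| + 1)).
  by rewrite (le_lt_trans (ler_norm A))// ltrDl.
have -> : `|A| + 1 = B `^ e.
  by rewrite /B -powRrM mulVf ?lt0r_neq0// powRr1// ltW.
apply: ge0_ler_powR; rewrite ?nnegrE ?powR_ge0 ?(ltW e0)//.
apply: (@le_trans _ _ (Num.truncn B).+1%:R).
  by rewrite ltW// truncnS_gt.
by rewrite ler_nat.
Qed.

End BergmanNorm.

(** * A criterion for non-nuclearity of a space lying between two Bergman spaces *)

Section NotNuclear.
Context (R : realType).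
Implicit Types (p m mu : R).

Lemma complex_gt0 (e : R[i]) : 0 < e -> exists2 s : R, 0 < s & e = s%:C.
Proof.
move=> e0; have eE : e = (complex.Re e)%:C by rewrite RRe_real// gtr0_real.
by exists (complex.Re e) => //; move: e0; rewrite {1}eE (ltcR 0).
Qed.

Lemma complex_ge0 (e : R[i]) : 0 <= e -> exists2 s : R, 0 <= s & e = s%:C.
Proof.
move=> e0; have eE : e = (complex.Re e)%:C by rewrite RRe_real// ger0_real.
by exists (complex.Re e) => //; move: e0; rewrite {1}eE (lecR 0).
Qed.

Lemma normc_real (s : R) : 0 <= s -> normc s%:C = s.
Proof. by move=> s0; rewrite /normc/= expr0n/= addr0 sqrtr_sqr ger0_norm. Qed.

(** Continuity at every point comes from smallness near 0 by the reverse triangle inequality. *)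
Lemma bergman_norm_continuous_seminorm (W : submod (R[i] -> R[i]))
    (B : lc_base (subspace_of W)) p m :
  1 < p -> W `<=` bergman p m ->
  (forall e : R, 0 < e -> exists2 U, lc_nbhs0 B U &
     forall f, U f -> bergman_norm p m (val f) < e) ->
  continuous_seminorm
    (fun f : lc_space B => (bergman_norm p m (val f))%:C : R[i]).
Proof.
move=> p1 Wb Be; have p0 : 0 < p := lt_trans ltr01 p1.
have bW (f : subspace_of W) : bergman p m (val f).
  by apply: Wb; have := valP f; rewrite inE.
have qD (f g : subspace_of W) : bergman_norm p m (val (f + g)) <=
    bergman_norm p m (val f) + bergman_norm p m (val g).
  exact: bergman_normD.
have qN (f : subspace_of W) :
    bergman_norm p m (val (- f)) = bergman_norm p m (val f).
  have -> : val (- f) = (-1 : R[i]) *: val f by rewrite raddfN scaleN1r.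
  by rewrite bergman_normZ// normcN normc1 mul1r.
have qB (f g : subspace_of W) : `|bergman_norm p m (val f) -
    bergman_norm p m (val (f + g))| <= bergman_norm p m (val g).
  have := qD f g; have := qD (f + g) (- g); rewrite addrK qN.
  move: (bergman_norm p m (val f)) (bergman_norm p m (val g)) => u v.
  move: (bergman_norm p m _) => w uwv wuv.
  by rewrite ler_norml; apply/andP; split; lra.
split.
- by move=> f; rewrite (lecR 0) bergman_norm_ge0.
- by move=> f g; rewrite -rmorphD lecR; exact: qD.
- move=> a f; rewrite Defs.normcE -rmorphM; congr _%:C.
  exact: bergman_normZ.
move=> f A /nbhs_ballP[e /= /complex_gt0[s s0 ->] eA].
have [U BU Us] := Be s s0.
exists U => // u /Us us; apply: eA.
rewrite -ball_normE /= -rmorphB Defs.normcE ltcR.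
rewrite -[normc _](_ : `|bergman_norm p m (val f) -
    bergman_norm p m (val (f + u : subspace_of W))| = _); last first.
  by rewrite /normc/= expr0n/= addr0 sqrtr_sqr.
exact: le_lt_trans (qB f u) us.
Qed.

(** The neighbourhood r < 1 contains a ball of radius d of the m-norm, and scaling by t = d / (2 b)
    brings f into it, so r f <= 1 / t. Taking a positive upper bound b instead of the norm itself
    avoids a division by 0. *)
Lemma continuous_seminorm_le (W : submod (R[i] -> R[i]))
    (B : lc_base (subspace_of W)) p m (r : lc_space B -> R[i]) :
  0 < p ->
  (forall U, lc_nbhs0 B U -> exists2 d : R, 0 < d &
     forall f, bergman p m (val f) -> bergman_norm p m (val f) < d -> U f) ->
  continuous_seminorm r ->
  exists2 D : R, 0 < D & forall (f : subspace_of W) (b : R), 0 < b ->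
    bergman p m (val f) -> bergman_norm p m (val f) <= b ->
    r f <= (D * b)%:C.
Proof.
move=> p0 hB [r0 rD rZ rc].
have r00 : r 0 = 0 by rewrite -(scale0r 0) rZ normr0 mul0r.
have [U BU Ur] : exists2 U, lc_nbhs0 B U & forall f, U f -> r f < 1.
  have /cvgrPdist_lt/(_ 1 ltr01) := rc 0.
  move=> [U BU Ur]; exists U => // f /Ur; rewrite add0r r00 sub0r normrN.
  by rewrite ger0_norm.
have [d d0 dU] := hB U BU.
exists (2 / d) => [|f b b0 bf fb]; first by rewrite divr_gt0.
pose t := d / (2 * b); have t0 : 0 < t by rewrite divr_gt0 ?mulr_gt0.
have : r (t%:C *: (f : lc_space B)) < 1.
  apply/Ur/dU; first exact: bergmanZ.
  have -> : val (t%:C *: f) = t%:C *: val f by rewrite linearZ.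
  rewrite bergman_normZ// normc_real ?(ltW t0)//.
  rewrite (le_lt_trans (ler_wpM2l (ltW t0) fb))//.
  rewrite /t (_ : d / (2 * b) * b = d / 2); last by field; rewrite gt_eqF.
  lra.
rewrite rZ Defs.normcE normc_real ?(ltW t0)//.
have [s s0 ->] := complex_ge0 (r0 f).
rewrite -rmorphM (ltcR _ 1) lecR -ltr_pdivlMl// => /ltW/le_trans; apply.
by rewrite mulr1 /t invf_div le_eqVlt mulrAC eqxx.
Qed.

(** The topology only has to be finer than that of the mu-norm and, on A^p_m, coarser than that of
    the m-norm, so one statement serves both spaces. *)
Lemma not_nuclear_space (W : submod (R[i] -> R[i]))
    (B : lc_base (subspace_of W)) p m mu :
  1 < p -> 0 <= m -> 0 <= mu -> mu - m < p - 1 ->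
  bergman p m `<=` W -> W `<=` bergman p mu ->
  (forall e : R, 0 < e -> exists2 U, lc_nbhs0 B U &
     forall f, U f -> bergman_norm p mu (val f) < e) ->
  (forall U, lc_nbhs0 B U -> exists2 d : R, 0 < d &
     forall f, bergman p m (val f) -> bergman_norm p m (val f) < d -> U f) ->
  ~ nuclear_space (lc_space B).
Proof.
move=> p1 m0 mu0 mmu bmW Wbmu Bq Br nE.
have p0 : 0 < p := lt_trans ltr01 p1.
have cq := bergman_norm_continuous_seminorm p1 Wbmu Bq.
have [r [cr [L /complex_ge0[l l0 ->] hL]]] := nuclear_space_summing nE cq.
have [D D0 hD] := continuous_seminorm_le p0 Br cr.
(* The same atoms are measured in both norms, so one k must exceed both weights. *)
pose k := (Num.truncn (m + mu)).+1.
have kk : m + mu <= k%:R by rewrite ltW// truncnS_gt.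
have mk : 0 <= m <= k%:R by rewrite m0 (le_trans _ kk)// lerDl.
have muk : 0 <= mu <= k%:R by rewrite mu0 (le_trans _ kk)// lerDr.
have [C C0 hC] := bergman_norm_sum_atom_le (ltW p1) mk.
have [c c0 hc] := bergman_norm_atom_ge (ltW p1) muk.
(* Summability would give N c N^(-(2 + mu)/p) <= l D C N^(-(1 + m)/p), that is N^e <= l D C / c for
   every N > 1. *)
pose e := 1 - (2 + mu) / p + (1 + m) / p.
have e0 : 0 < e.
  have -> : e = (p - 1 - (mu - m)) / p by rewrite /e; field; rewrite gt_eqF.
  by rewrite divr_gt0// subr_gt0.
have [N N1] := powR_nat_unbounded (l * (D * C) / c) e0.
apply/negP; rewrite -leNgt ler_pdivlMr//.
have N0 : (0 < N)%N := ltnW N1.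
have n0 : 0 < N%:R :> R by rewrite ltr0n.
have Wa (i : 'I_N) : submod_set W (@atom R N k i).
  by apply: bmW; exact: bergman_atom (ltW p1) mk (ltn_ord i).
pose x (i : 'I_N) : subspace_of W := Subspace (mem_set (Wa i)).
pose b := C * N%:R `^ (- ((1 + m) / p)).
have b0 : 0 < b by rewrite mulr_gt0// powR_gt0.
have : \sum_i (bergman_norm p mu (val (x i)))%:C <= l%:C * (D * b)%:C :> R[i].
  apply: hL => a a1.
  have vE : val (\sum_i a i *: x i) = \sum_i a i *: @atom R N k i.
    by rewrite raddf_sum.
  have [] := hC N a N0 a1; rewrite -vE => bx xb.
  exact: (hD _ b b0 bx xb).
rewrite -rmorph_sum -rmorphM lecR => h.
have : \sum_(i < N) c * N%:R `^ (- ((2 + mu) / p)) <= l * (D * b).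
  by apply: le_trans h; apply: ler_sum => i _; exact: hc.
rewrite sumr_const card_ord -[leLHS]mulr_natl.
rewrite /b => {}h.
have nz := gt_eqF n0.
have -> : e = 1 + (- ((2 + mu) / p)) + (1 + m) / p by [].
rewrite !powRD ?nz ?implybT// powRr1 ?(ltW n0)//.
have P0 : 0 < N%:R `^ ((1 + m) / p) by rewrite powR_gt0.
move: h; rewrite (powRN _ ((1 + m) / p)).
set P := N%:R `^ ((1 + m) / p) in P0 *; set Q := N%:R `^ _ => h.
have := ler_wpM2r (ltW P0) h.
rewrite (_ : l * (D * (C / P)) * P = l * (D * C)); last by field; rewrite gt_eqF.
by apply: le_trans; rewrite le_eqVlt; apply/orP; left; apply/eqP; ring.
Qed.

End NotNuclear.

(** * The intersection space and the inductive limit *)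

Lemma subconvex_lt (R : realDomainType) (a b u v e : R) :
  0 <= a -> 0 <= b -> 0 <= u -> 0 <= v -> a + b <= 1 -> u < e -> v < e ->
  a * u + b * v < e.
Proof.
move=> a0 b0 u0 v0 ab ue ve; have [uv|/ltW vu] := leP u v.
  apply: le_lt_trans ve; apply: le_trans (_ : (a + b) * v <= _).
    by rewrite mulrDl lerD2r ler_wpM2l.
  by rewrite ler_piMl.
apply: le_lt_trans ue; apply: le_trans (_ : (a + b) * u <= _).
  by rewrite mulrDl lerD2l ler_wpM2l.
by rewrite ler_piMl.
Qed.

Section Spaces.
Context (R : realType) (p : R) (p1 : 1 < p) (alpha : R) (alpha0 : 0 < alpha).

Let p0 : 0 < p. Proof. exact: lt_trans p1. Qed.

(** The criterion is applied with m = alpha and mu = alpha + 1/(n + 1), where 1/(n + 1) < p - 1: all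
    the defining norms are bounded by the norm of weight alpha. *)
Lemma bergman_plus_not_nuclear : ~ nuclear_space (bergman_plus p1 alpha).
Proof.
have [n hn] : exists n : nat, n.+1%:R^-1 < p - 1.
  have d0 : 0 < p - 1 by rewrite subr_gt0.
  exists (Num.truncn (p - 1)^-1).
  by rewrite invf_plt ?posrE// truncnS_gt.
have n0 : 0 < n.+1%:R^-1 :> R by rewrite invr_gt0.
apply: (@not_nuclear_space _ _ (bergman_plus_base p1 alpha) p alpha
  (alpha + n.+1%:R^-1)) => //.
- exact: ltW.
- by rewrite addr_ge0// ltW.
- by rewrite addrAC subrr add0r.
- rewrite -[X in _ `<=` X]/(bergman_plus_set p alpha) => f bf mu /= /ltW amu.
  exact: sub_bergman bf.
- by move=> f bf; apply: (bf : bergman_plus_set p alpha f); rewrite /= ltrDl.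
- move=> e e0; exists (@bergman_plus_ball R p p1 alpha n e).
    by exists n, e.
  by move=> f; apply.
move=> U [N [e e0 ->]]; exists e => // f bf fe j _.
by apply: le_lt_trans fe; apply: ler_bergman_norm => //; rewrite lerDl.
Qed.

Lemma bergman_minus_not_nuclear : ~ nuclear_space (bergman_minus p1 alpha0).
Proof.
(* Here mu = alpha is the larger weight. The second entry keeps alpha - m < p - 1, and the first
   keeps m positive. *)
pose m := Num.max (alpha / 2) (alpha - (p - 1) / 2).
have d0 : 0 < p - 1 by rewrite subr_gt0.
have m0 : 0 < m by rewrite lt_max divr_gt0.
have ma : m < alpha.
  by rewrite gt_max; apply/andP; split; have := alpha0; lra.
have minus_alpha f : bergman_minus_set p alpha f -> bergman p alpha f.
  by move=> [mu /= /andP[_ /ltW mua]]; exact: sub_bergman.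
apply: (@not_nuclear_space _ _ (bergman_minus_base p1 alpha0) p m alpha) => //.
- exact: ltW.
- exact: ltW.
- rewrite ltrBlDr -ltrBlDl lt_max; apply/orP; right; lra.
- rewrite -[X in _ `<=` X]/(bergman_minus_set p alpha) => f bf.
  by exists m; rewrite //= m0.
(* The ball of the alpha-norm is an admissible neighbourhood: on every step A^p_mu with mu < alpha,
   the alpha-norm is at most the mu-norm. *)
- move=> e e0; exists [set f | bergman_norm p alpha (val f) < e] => //.
  split=> [f g a b /= fe ge ab|mu /andP[mu0 mua]]; last first.
    exists e; first exact: e0.
    move=> f bf fe.
    exact: le_lt_trans (ler_bergman_norm p0 (ltW mua) bf) fe.
  have bW (h : subspace_of (bergman_minus_submod p1 alpha0)) :
      bergman p alpha (val h).
    by apply: minus_alpha; have := valP h; rewrite inE.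
  apply: le_lt_trans (bergman_normD p1 (bergmanZ a p0 (bW f))
    (bergmanZ b p0 (bW g))) _.
  rewrite !bergman_normZ//.
  have {}ab : normc a + normc b <= 1.
    by move: ab; rewrite !Defs.normcE -rmorphD (lecR _ 1).
  exact: subconvex_lt (normc_ge0 a) (normc_ge0 b) (bergman_norm_ge0 _ _ _)
    (bergman_norm_ge0 _ _ _) ab fe ge.
by move=> U [_ /(_ m)]; apply; rewrite m0.
Qed.

End Spaces.

Theorem theorem3p5 (R : realType) (p : R) (p1 : 1 < p)
    (alpha : R) (alpha0 : 0 < alpha) :
  ~ nuclear_space (bergman_plus p1 alpha) /\
  ~ nuclear_space (bergman_minus p1 alpha0).
Proof.
by split; [exact: bergman_plus_not_nuclear|exact: bergman_minus_not_nuclear].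
Qed.
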